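(* Let $T>0$ be fixed, let $K$ be a kernel with $K\ge 0$, $\dot K\le 0$ and $\|K\|_{L_1(0,T)}=\kappa<1$, and let $V$, $H$, $a(\cdot,\cdot)$, $\partial\Omega_{\mathrm N}$, $\varphi_1,\dots,\varphi_m$, $P^0$, $P^1$ be as described in the context. Assume that the initial data $u^0$ and $u^1$ are regular such that the initial conditions $$u_m(0)=P^0u^0,\qquad \dot u_m(0)=P^1u^1$$ are well-defined, and that $g\in L_1((0,T);L_2(\partial\Omega_{\mathrm N})^d)$ and $f\in L_1((0,T);H)$. Then, for each $m\in\mathbb N$, there exists a unique function $u_m$ of the form $$u_m(t)=\sum_{j=1}^m\alpha_j(t)\varphi_j$$ satisfying $$(\ddot u_m(t),\varphi_k)+a(u_m(t),\varphi_k)-\int_0^t K(t-s)\,a(u_m(s),\varphi_k)\,ds=(f(t),\varphi_k)+(g(t),\varphi_k)_{\partial\Omega_{\mathrm N}},\qquad k=1,\dots,m,\ t\in(0,T),$$ together with the initial conditions $u_m(0)=P^0u^0$, $\dot u_m(0)=P^1u^1$.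
   Context: A dot denotes $\partial/\partial t$. $\Omega\subset\mathbb R^d$, $d\in\{1,2,3\}$, is a bounded polygonal domain with boundary $\partial\Omega=\partial\Omega_{\mathrm D}\cup\partial\Omega_{\mathrm N}$, where $\partial\Omega_{\mathrm D}$ and $\partial\Omega_{\mathrm N}$ are disjoint and $\operatorname{meas}(\partial\Omega_{\mathrm D})\ne0$. Put $H=L_2(\Omega)^d$ with inner product $(\cdot,\cdot)$, $V=\{v\in H^1(\Omega)^d: v|_{\partial\Omega_{\mathrm D}}=0\}$, and $(g,v)_{\partial\Omega_{\mathrm N}}=\int_{\partial\Omega_{\mathrm N}} g\cdot v\,dS$. The kernel $K$ is either smooth (exponential) or no worse than weakly singular, that is, singular at the origin but locally integrable. $A$ is a self-adjoint, positive definite, uniformly elliptic second order linear operator, and $a(\cdot,\cdot)$ is the associated symmetric, coercive bilinear form on $V$; the chief example is $a(u,v)=\int_\Omega\big(2\mu\,\epsilon_{ij}(u)\epsilon_{ij}(v)+\lambda\,\epsilon_{ii}(u)\epsilon_{jj}(v)\big)dx$ (summation convention), with $\epsilon$ the strain tensor and $\lambda,\mu$ elastic constants of Lamé type. The norm $\|v\|_V=a(v,v)^{1/2}$ is equivalent to the $H^1$ norm on $V$. For each $m$, $V_h=\operatorname{span}\{\varphi_1,\dots,\varphi_m\}$ is a finite dimensional subspace of $V$ with basis $\varphi_1,\dots,\varphi_m$. The two choices considered are: a standard finite element space of continuous piecewise polynomials corresponding to a triangulation of $\Omega$ (local Galerkin method); and the span of $m$ eigenfunctions $\varphi_1,\dots,\varphi_m$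 of the weak eigenvalue problem $a(\varphi,v)=\lambda(\varphi,v)$ for all $v\in V$, where the eigenfunctions $\{\varphi_j\}_{j=1}^\infty$ are chosen to be an orthonormal basis of $H$ and an orthogonal basis of $V$ (global, or spectral, Galerkin method). $P^0,P^1$ are suitable projections onto $V_h$ to be chosen, such as the $L_2$-projection $P_h:H\to V_h$, $(P_hv,\chi)=(v,\chi)$ for all $\chi\in V_h$; the Ritz projection $R_h:V\to V_h$, $a(R_hv,\chi)=a(v,\chi)$ for all $\chi\in V_h$; or the truncated Fourier series projection $P_F:H\to V_h$, $P_Fv=\sum_{j=1}^m(v,\varphi_j)\varphi_j$, with $\varphi_j$ the eigenfunctions above. *)

(* Defs.v *)
From HB Require Import structures.
From mathcomp Require Import all_boot all_order all_algebra.
From mathcomp Require Import all_classical all_reals all_analysis.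

(* Elements of an L2 space are represented by functions on the whole of R^d,    *)
(* compared almost everywhere on the domain.                                    *)

Set Implicit Arguments.
Unset Strict Implicit.
Unset Printing Implicit Defensive.

Import Order.TTheory GRing.Theory Num.Theory.
Import numFieldNormedType.Exports.

Local Open Scope classical_set_scope.
Local Open Scope ring_scope.

Section cover_outer_measure.
Context (R : realType) (E : pointedType).
Variable w : set E -> \bar R.
Local Open Scope ereal_scope.

(* Pieces may be empty, at no cost. *)
Definition piece_weight (A : set E) : \bar R :=
  if `[< A = set0 >] then 0 else w A.

Definition cover_outer (A : set E) : \bar R :=
  ereal_inf [set \sum_(k <oo) piece_weight (F k) |
    F in [set F : (set E)^nat | A `<=` \bigcup_k F k]].

Hypothesis w_ge0 : forall A, 0 <= w A.

Lemma piece_weight_ge0 A : 0 <= piece_weight A.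
Proof. by rewrite /piece_weight; case: asboolP. Qed.

Lemma piece_weight0 : piece_weight set0 = 0.
Proof. by rewrite /piece_weight; case: asboolP. Qed.

Lemma cover_outer0 : cover_outer set0 = 0.
Proof.
apply/eqP; rewrite eq_le; apply/andP; split.
  apply: ereal_inf_lbound; exists (fun=> set0) => //.
  by rewrite eseries0// => n _ _; exact: piece_weight0.
apply: le_ereal_inf_tmp => _ [F _ <-].
by apply: nneseries_ge0 => n _ _; exact: piece_weight_ge0.
Qed.

Lemma cover_outer_ge0 A : 0 <= cover_outer A.
Proof.
apply: le_ereal_inf_tmp => _ [F _ <-].
by apply: nneseries_ge0 => n _ _; exact: piece_weight_ge0.
Qed.

Lemma le_cover_outer : {homo cover_outer : A B / A `<=` B >-> A <= B}.
Proof.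
move=> A B AB; apply/ereal_inf_le_tmp => _ [F BF <-].
by exists F => //; exact: subset_trans BF.
Qed.

Lemma cover_outer_sigma_subadditive : sigma_subadditive cover_outer.
Proof.
pose D := g_sigma_algebraType [set: set E].
have mD (A : set D) : measurable A by exact: sub_gen_smallest.
have coverE (A : set E) : cover_outer A = @mu_ext _ D R piece_weight A.
  rewrite /cover_outer /mu_ext; congr ereal_inf; congr image.
  apply/seteqP; split => F /=; first by move=> AF; split => // i; exact: mD.
  by case.
move=> F; rewrite coverE; under eq_eseriesr do rewrite coverE.
apply: (@mu_ext_sigma_subadditive _ D R piece_weight).
exact: piece_weight_ge0.
Qed.

End cover_outer_measure.

Section euclidean_space.
Context (R : realType).

Definition mxdot p q (A B : 'M[R]_(p, q)) : R :=
  \sum_(i < p) \sum_(j < q) A i j * B i j.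

(* The library norm of 'rV[R]_d is the sup norm. *)
Definition enorm d (x : 'rV[R]_d) : R := Num.sqrt (mxdot x x).

Definition closed_box d (a b : 'rV[R]_d) : set 'rV[R]_d :=
  [set x | forall i, a 0 i <= x 0 i <= b 0 i].

Definition box_weight d (A : set 'rV[R]_d) : \bar R :=
  ereal_inf [set (\prod_(i < d) (ab.2 0 i - ab.1 0 i))%:E |
    ab in [set ab : 'rV[R]_d * 'rV[R]_d |
      (forall i, ab.1 0 i <= ab.2 0 i) /\ A = closed_box ab.1 ab.2]].

Definition box_outer d (A : set 'rV[R]_d) : \bar R :=
  cover_outer (@box_weight d) A.

Lemma box_weight_ge0 d (A : set 'rV[R]_d) : (0 <= box_weight A)%E.
Proof.
apply: le_ereal_inf_tmp => _ [[a b] [/= ab _] <-].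
by rewrite lee_fin; apply: prodr_ge0 => i _; rewrite subr_ge0.
Qed.

HB.instance Definition _ d := isOuterMeasure.Build R 'rV[R]_d
  (@box_outer d)
  (cover_outer0 (@box_weight_ge0 d))
  (cover_outer_ge0 (@box_weight_ge0 d))
  (@le_cover_outer _ _ (@box_weight d))
  (cover_outer_sigma_subadditive (@box_weight_ge0 d)).

Definition lebesgue_outer d : {outer_measure set 'rV[R]_d -> \bar R} :=
  @box_outer d.

(* Lebesgue measure on the Lebesgue (Caratheodory) measurable sets of R^d. *)
Definition lebesgue_rV d :
    {measure set (caratheodory_type (lebesgue_outer d)) -> \bar R} :=
  (lebesgue_outer d : set (caratheodory_type (lebesgue_outer d)) -> \bar R).

Definition diam d (A : set 'rV[R]_d) : \bar R :=
  ereal_sup [set (enorm (xy.1 - xy.2))%:E | xy in A `*` A].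

(* Volume of the s-dimensional ball of diameter 1, for s = 0, 1, 2: with this   *)
(* factor the Hausdorff measure is the counting, length or area measure.        *)
Definition hausdorff_const (s : nat) : R :=
  match s with 0%N | 1%N => 1 | _ => pi / 4 end.

Lemma hausdorff_const_ge0 s : 0 <= hausdorff_const s.
Proof. by case: s => [|[|s]] //=; rewrite divr_ge0 ?pi_ge0. Qed.

(* The max only matters for A = set0, which cover_outer never weighs. *)
Definition diam_weight d (s : nat) (delta : R) (A : set 'rV[R]_d) : \bar R :=
  if (diam A <= delta%:E)%E
  then (hausdorff_const s * Num.max 0 (fine (diam A)) ^+ s)%:E else +oo%E.

Definition diam_outer d (s : nat) (A : set 'rV[R]_d) : \bar R :=
  ereal_sup [set cover_outer (@diam_weight d s delta) A |
    delta in [set delta : R | 0 < delta]].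

Lemma diam_weight_ge0 d s delta (A : set 'rV[R]_d) :
  (0 <= diam_weight s delta A)%E.
Proof.
rewrite /diam_weight; case: ifP => _ //.
by rewrite lee_fin mulr_ge0 ?hausdorff_const_ge0// exprn_ge0// le_max lexx.
Qed.

Lemma diam_outer0 d s : @diam_outer d s set0 = 0%E.
Proof.
rewrite /diam_outer; apply/eqP; rewrite eq_le; apply/andP; split.
  apply: ge_ereal_sup => _ [e _ <-].
  by rewrite cover_outer0//; exact: diam_weight_ge0.
apply: ereal_sup_ubound; exists 1; first exact: ltr01.
by rewrite cover_outer0//; exact: diam_weight_ge0.
Qed.

Lemma diam_outer_ge0 d s (A : set 'rV[R]_d) :
  (0 <= diam_outer s A)%E.
Proof.
apply: (@le_trans _ _ (cover_outer (@diam_weight d s 1) A)).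
  by apply: cover_outer_ge0; exact: diam_weight_ge0.
by apply: ereal_sup_ubound; exists 1 => //=; exact: ltr01.
Qed.

Lemma le_diam_outer d s :
  {homo @diam_outer d s : A B / A `<=` B >-> (A <= B)%E}.
Proof.
move=> A B AB; apply: ge_ereal_sup => _ [e e0 <-].
apply: (le_trans (le_cover_outer _ AB)).
by apply: ereal_sup_ubound; exists e.
Qed.

Lemma diam_outer_sigma_subadditive d s :
  sigma_subadditive (@diam_outer d s).
Proof.
move=> F; apply: ge_ereal_sup => _ [e e0 <-].
have /cover_outer_sigma_subadditive := @diam_weight_ge0 d s e.
move=> /(_ F) /le_trans; apply.
apply: lee_nneseries => [n _ _|n _].
  by apply: cover_outer_ge0; exact: diam_weight_ge0.
by apply: ereal_sup_ubound; exists e.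
Qed.

HB.instance Definition _ d s := isOuterMeasure.Build R 'rV[R]_d
  (@diam_outer d s)
  (@diam_outer0 d s) (@diam_outer_ge0 d s)
  (@le_diam_outer d s) (@diam_outer_sigma_subadditive d s).

Definition hausdorff_outer d (s : nat) :
  {outer_measure set 'rV[R]_d -> \bar R} := @diam_outer d s.

(* Surface measure of R^d: (d-1)-dimensional Hausdorff measure, on its          *)
(* Caratheodory measurable sets (which include the Borel sets).                 *)
Definition surface_measure d :
    {measure set (caratheodory_type (hausdorff_outer d d.-1)) -> \bar R} :=
  (hausdorff_outer d d.-1 :
    set (caratheodory_type (hausdorff_outer d d.-1)) -> \bar R).

End euclidean_space.

Section L2_spaces.
Context (R : realType) (disp : measure_display) (X : measurableType disp).
Variables (mu : {measure set X -> \bar R}) (D : set X) (p q : nat).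
Implicit Types u v : X -> 'M[R]_(p, q).

Definition sqnorm v : \bar R := (\int[mu]_(x in D) (mxdot (v x) (v x))%:E)%E.

(* measurable_fun D holds trivially when D is not measurable, hence the first   *)
(* component.                                                                   *)
Definition L2 v : Prop :=
  [/\ measurable D,
      forall i j, measurable_fun D (fun x => v x i j) &
      (sqnorm v < +oo)%E].

Definition ip u v : R := \int[mu]_(x in D) mxdot (u x) (v x).

Definition L2norm v : R := Num.sqrt (fine (sqnorm v)).

Definition L2_cvg (vn : nat -> X -> 'M[R]_(p, q)) v : Prop :=
  sqnorm (fun x => vn n x - v x) @[n --> \oo] --> 0%E.

(* Bochner spaces of functions of t in ]0, T[ with values in L2(D). *)
Definition simple_L2_valued (f : R -> X -> 'M[R]_(p, q)) : Prop :=
  exists (N : nat) (A : 'I_N -> set R) (h : 'I_N -> X -> 'M[R]_(p, q)),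
    [/\ forall i, measurable (A i), forall i, L2 (h i) &
        forall t, f t = fun x => \sum_(i < N) \1_(A i) t *: h i x].

Definition bochner_L1 (T : R) (f : R -> X -> 'M[R]_(p, q)) : Prop :=
  [/\ forall t, 0 < t < T -> L2 (f t),
      exists2 fn : nat -> R -> X -> 'M[R]_(p, q),
        forall n, simple_L2_valued (fn n) &
        {ae (@lebesgue_measure R), forall t, 0 < t < T ->
           L2_cvg (fun n => fn n t) (f t)} &
      (\int[@lebesgue_measure R]_(t in `]0%R, T[) (L2norm (f t))%:E < +oo)%E].

End L2_spaces.

Section domain.
Context (R : realType) (d : nat).
Implicit Types (Omega : set 'rV[R]_d) (v w : 'rV[R]_d -> 'rV[R]_d).

Definition simplex (P : 'I_d.+1 -> 'rV[R]_d) : set 'rV[R]_d :=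
  [set x | exists l : 'I_d.+1 -> R,
    [/\ forall i, 0 <= l i, \sum_i l i = 1 & x = \sum_i l i *: P i]].

(* Interval, polygon or polyhedron: a nonempty connected open set which is the  *)
(* interior of a finite union of simplices (so bounded, on one side of every    *)
(* face).                                                                       *)
Definition polygonal_domain Omega : Prop :=
  [/\ Omega !=set0, connected Omega &
      exists (n : nat) (P : 'I_n -> 'I_d.+1 -> 'rV[R]_d),
        Omega = interior [set x | exists k, simplex (P k) x]].

Definition boundary Omega : set 'rV[R]_d := closure Omega `\` interior Omega.

Definition partial (i : 'I_d) (psi : 'rV[R]_d -> R) : 'rV[R]_d -> R :=
  fun x => 'D_(delta_mx 0 i) psi x.

Definition smooth (psi : 'rV[R]_d -> R) : Prop :=
  forall (s : seq 'I_d) (x : 'rV[R]_d), differentiable (foldr partial psi s) x.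

Definition test_function Omega (psi : 'rV[R]_d -> R) : Prop :=
  [/\ smooth psi, compact (closure [set x | psi x != 0]) &
      closure [set x | psi x != 0] `<=` Omega].

(* G x i j is the j-th weak derivative of the i-th component. *)
Definition weak_grad Omega v (G : 'rV[R]_d -> 'M[R]_d) : Prop :=
  L2 (lebesgue_rV R d) Omega G /\
  forall (psi : 'rV[R]_d -> R), test_function Omega psi ->
  forall i j : 'I_d,
    \int[lebesgue_rV R d]_(x in Omega) (v x 0 i * partial j psi x) =
    - \int[lebesgue_rV R d]_(x in Omega) (G x i j * psi x).

Definition H1 Omega v : Prop :=
  L2 (lebesgue_rV R d) Omega v /\ exists G, weak_grad Omega v G.

Definition smooth_field v : Prop := forall i, smooth (fun x => v x 0 i).

Definition jacobian_mx v (x : 'rV[R]_d) : 'M[R]_d :=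
  \matrix_(i, j) partial j (fun y => v y 0 i) x.

(* The trace operator is the continuous extension to H^1 of the restriction of  *)
(* smooth fields to the boundary.                                               *)
Definition is_trace Omega v w : Prop :=
  L2 (surface_measure R d) (boundary Omega) w /\
  exists (G : 'rV[R]_d -> 'M[R]_d) (vn : nat -> 'rV[R]_d -> 'rV[R]_d),
    [/\ weak_grad Omega v G, forall n, smooth_field (vn n),
        L2_cvg (lebesgue_rV R d) Omega vn v,
        L2_cvg (lebesgue_rV R d) Omega (fun n => jacobian_mx (vn n)) G &
        L2_cvg (surface_measure R d) (boundary Omega) vn w].

(* Unique up to a null set of the boundary. *)
Definition trace Omega v : 'rV[R]_d -> 'rV[R]_d := get (is_trace Omega v).

(* GD stands for the Dirichlet part of the boundary. *)
Definition space_V Omega (GD : set 'rV[R]_d) : set ('rV[R]_d -> 'rV[R]_d) :=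
  [set v | H1 Omega v /\
    exists2 w, is_trace Omega v w &
      w = (fun=> 0) %[ae (surface_measure R d) in GD]].

Definition eq_H Omega v w : Prop := v = w %[ae (lebesgue_rV R d) in Omega].

End domain.

Section elliptic_form.
Context (R : realType) (d : nat).
Variables (Omega : set 'rV[R]_d) (V : set ('rV[R]_d -> 'rV[R]_d)).
Variable a : ('rV[R]_d -> 'rV[R]_d) -> ('rV[R]_d -> 'rV[R]_d) -> R.

Definition bilinear_on : Prop :=
  forall (c : R) u v w, V u -> V v -> V w ->
    a (fun x => c *: u x + v x) w = c * a u w + a v w /\
    a w (fun x => c *: u x + v x) = c * a w u + a w v.

Definition symmetric_on : Prop := forall u v, V u -> V v -> a u v = a v u.

(* Coercivity and boundedness: a(v,v)^(1/2) is equivalent to the H^1 norm. *)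
Definition equivalent_H1_norm : Prop :=
  exists c1 c2 : R, [/\ 0 < c1, 0 < c2 &
    forall v G, V v -> weak_grad Omega v G ->
      let n := ip (lebesgue_rV R d) Omega v v + ip (lebesgue_rV R d) Omega G G in
      c1 * n <= a v v <= c2 * n].

(* Form of a general self-adjoint second order system with bounded measurable   *)
(* coefficients; C is the leading part, for which uniform ellipticity is the    *)
(* Legendre-Hadamard condition, as satisfied by linear elasticity               *)
(* C_ijkl = lambda d_ij d_kl + mu (d_ik d_jl + d_il d_jk), B = 0, c = 0.        *)
Definition second_order_elliptic : Prop :=
  exists (C : 'rV[R]_d -> 'I_d -> 'I_d -> 'I_d -> 'I_d -> R)
         (B : 'rV[R]_d -> 'I_d -> 'I_d -> 'I_d -> R)
         (c : 'rV[R]_d -> 'I_d -> 'I_d -> R) (M c0 : R),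
  let Xd := caratheodory_type (lebesgue_outer R d) in
  [/\ 0 < c0,
      forall i j k l, [/\
        measurable_fun (Omega : set Xd) (fun x : Xd => C x i j k l),
        measurable_fun (Omega : set Xd) (fun x : Xd => B x i j k) &
        measurable_fun (Omega : set Xd) (fun x : Xd => c x i k)],
      {ae (lebesgue_rV R d), forall x, Omega x -> forall i j k l,
        [/\ C x i j k l = C x k l i j, c x i k = c x k i,
            `|C x i j k l| <= M, `|B x i j k| <= M & `|c x i k| <= M]},
      {ae (lebesgue_rV R d), forall x, Omega x -> forall xi eta : 'rV[R]_d,
        c0 * mxdot xi xi * mxdot eta eta <=
        \sum_i \sum_j \sum_k \sum_l
          C x i j k l * xi 0 i * eta 0 j * xi 0 k * eta 0 l} &
      forall u v Gu Gv, V u -> V v -> weak_grad Omega u Gu ->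
        weak_grad Omega v Gv ->
        a u v = \int[lebesgue_rV R d]_(x in Omega)
          (\sum_i \sum_j \sum_k \sum_l C x i j k l * Gu x i j * Gv x k l
         + \sum_i \sum_j \sum_k
             B x i j k * (Gu x i j * v x 0 k + u x 0 k * Gv x i j)
         + \sum_i \sum_k c x i k * u x 0 i * v x 0 k)].

Definition elliptic_form : Prop :=
  [/\ bilinear_on, symmetric_on, equivalent_H1_norm & second_order_elliptic].

End elliptic_form.

Section galerkin.
Context (R : realType) (d m : nat).
Variables (Omega : set 'rV[R]_d) (phi : 'I_m -> 'rV[R]_d -> 'rV[R]_d).

Definition combination (c : 'I_m -> R) : 'rV[R]_d -> 'rV[R]_d :=
  fun x => \sum_(j < m) c j *: phi j x.

Definition space_Vh : set ('rV[R]_d -> 'rV[R]_d) :=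
  [set v | exists c, eq_H Omega v (combination c)].

Definition lin_indep : Prop :=
  forall c, eq_H Omega (combination c) (fun=> 0) -> forall j, c j = 0.

(* A linear projection onto Vh with domain dom, a subspace of H (such as H for  *)
(* the L2 projection and the truncated Fourier series, V for the Ritz           *)
(* projection).                                                                 *)
Definition projection_onto_Vh (dom : set ('rV[R]_d -> 'rV[R]_d))
    (P : ('rV[R]_d -> 'rV[R]_d) -> 'rV[R]_d -> 'rV[R]_d) : Prop :=
  [/\ forall v, dom v -> L2 (lebesgue_rV R d) Omega v,
      space_Vh `<=` dom,
      forall (c : R) u v, dom u -> dom v ->
        dom (fun x => c *: u x + v x) /\
        eq_H Omega (P (fun x => c *: u x + v x))
                   (fun x => c *: P u x + P v x),
      forall v, dom v -> space_Vh (P v) &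
      forall v, space_Vh v -> eq_H Omega (P v) v].

Definition abs_continuous (a b : R) (f : R -> R) : Prop :=
  forall eps : R, 0 < eps -> exists2 delta : R, 0 < delta &
  forall (n : nat) (I : 'I_n -> R * R),
    (forall i, a <= (I i).1 /\ (I i).1 <= (I i).2 /\ (I i).2 <= b) ->
    (forall i j, i != j -> (I i).2 <= (I j).1 \/ (I j).2 <= (I i).1) ->
    \sum_i ((I i).2 - (I i).1) < delta ->
    \sum_i `|f (I i).2 - f (I i).1| < eps.

(* Since f and g are only integrable in time, a solution is sought with         *)
(* coefficients al in W^{2,1}(0,T): al is C^1 on [0,T] with derivative al1      *)
(* absolutely continuous, so that the second derivative al2 exists almost       *)
(* everywhere, and the equation holds for almost every t. The values            *)
(* al1 _ 0 are one-sided derivatives.                                           *)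
Definition galerkin_solution (GN : set 'rV[R]_d) (T : R) (K : R -> R)
    (a : ('rV[R]_d -> 'rV[R]_d) -> ('rV[R]_d -> 'rV[R]_d) -> R)
    (f g : R -> 'rV[R]_d -> 'rV[R]_d) (v0 v1 : 'rV[R]_d -> 'rV[R]_d)
    (u : R -> 'rV[R]_d -> 'rV[R]_d) : Prop :=
  exists al al1 al2 : 'I_m -> R -> R,
  [/\ forall t, 0 <= t <= T -> u t = combination (al ^~ t),
      forall j, [/\ {within `[0, T], continuous (al j)},
        forall t, 0 < t < T -> is_derive t (1 : R) (al j) (al1 j t) &
        abs_continuous 0 T (al1 j)],
      eq_H Omega (u 0) v0,
      eq_H Omega (combination (al1 ^~ 0)) v1 &
      {ae (@lebesgue_measure R), forall t, 0 < t < T ->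
        (forall j, is_derive t (1 : R) (al1 j) (al2 j t)) /\
        forall k : 'I_m,
          ip (lebesgue_rV R d) Omega (combination (al2 ^~ t)) (phi k)
          + a (u t) (phi k)
          - \int[@lebesgue_measure R]_(s in `[0, t]) (K (t - s) * a (u s) (phi k))
          = ip (lebesgue_rV R d) Omega (f t) (phi k)
            + ip (surface_measure R d) GN (g t) (trace Omega (phi k))}].

End galerkin.

(* Main.v *)
(** In the basis phi the Galerkin equations read
    M al'' + S al - K * (S al) = F, with an invertible mass matrix M, the
    stiffness matrix S and load F, which agrees almost everywhere with a Borel
    function in L1(0, T). If al'' = h(u) is solved with the right-hand side
    frozen at u, two right-hand sides differing by at most D exp(lam t) give
    solutions differing by at most C D exp(lam t) / lam^2, where C depends on
    M, S and the L1 norm of K only. For lam large this is a contraction in the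
    norm weighted by exp(- lam t) on the whole of [0, T]: Picard iteration gives
    existence, and iterating the estimate on the difference of two solutions
    gives uniqueness. The estimate rests on the fact that an absolutely
    continuous function with nonpositive derivative almost everywhere is
    nonincreasing. *)

From HB Require Import structures.
Require Import Defs.
From mathcomp Require Import all_boot all_order all_algebra.
From mathcomp Require Import all_classical all_reals all_analysis.
From mathcomp Require Import measurable_realfun.
From mathcomp Require Import lra ring.

Set Implicit Arguments.
Unset Strict Implicit.
Unset Printing Implicit Defensive.

Import Order.TTheory GRing.Theory Num.Theory.
Import numFieldNormedType.Exports.

Local Open Scope classical_set_scope.
Local Open Scope ring_scope.

(** * Absolutely continuous functions *)

(** For an arbitrary solution the second derivative is given only pointwise almost everywhere, with
    no integrability attached, so growth cannot be read off from an integral of it. The bound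
    [C * expR (lam * t)] is compared instead with its own primitive, which is [lam] times smaller;
    this is done once for the first derivative and once for the function, whence the factor
    [1 / lam ^+ 2]. An exponential weight suits the memory term because it increases: at time t only
    times s <= t enter, where the weight is at most its value at t, so the memory costs no more than
    the L1 norm of the kernel. *)

Lemma is_derive_slope (R : realType) (f : R -> R) (s l e : R) :
  is_derive s (1 : R) f l -> l < e ->
  exists2 eta : R, 0 < eta & forall x y, s - eta < x -> x <= s -> s <= y ->
    y < s + eta -> f y - f x <= e * (y - x).
Proof.
move=> [df dl] le.
have : h^-1 *: (f (h *: 1 + s) - f s) @[h --> (0:R)^'] --> l.
  by rewrite -dl; exact: df.
move=> /cvgr_lt /(_ _ le) /nbhs_ballP[eta /= eta0 Heta].
have H h : h != 0 -> `|h| < eta -> (f (h + s) - f s) / h < e.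
  move=> h0 he; have := Heta h; rewrite /ball/= sub0r normrN => /(_ he h0).
  by rewrite /= /GRing.scale/= mulr1 mulrC.
exists eta => // x y sx xs sy ys.
(* As [x] and [y] lie on either side of [s], the increment splits at [s] into two pieces, each
   controlled by the derivative at [s] alone. *)
have Hy : f y - f s <= e * (y - s).
  have [->|ys0] := eqVneq y s; first by rewrite !subrr mulr0.
  have y0 : 0 < y - s by rewrite subr_gt0 lt_neqAle eq_sym ys0.
  have := H (y - s); rewrite gt_eqF// => /(_ isT); rewrite gtr0_norm// subrK.
  rewrite ltr_pdivrMr// => /(_ _)/ltW; apply; lra.
have Hx : f s - f x <= e * (s - x).
  have [->|xs0] := eqVneq x s; first by rewrite !subrr mulr0.
  have x0 : x - s < 0 by rewrite subr_lt0 lt_neqAle xs0.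
  have := H (x - s); rewrite lt_eqF// => /(_ isT); rewrite ltr0_norm// subrK.
  rewrite ltr_ndivrMr// => /(_ _) HH; have {}HH : e * (x - s) < f x - f s by apply: HH; lra.
  lra.
lra.
Qed.

(* Real induction on t, as in Cousin's lemma: off an open set U of small measure
   the increments of f are at most e times the increments of t, and the pieces
   lying in U are collected in a finite family, handled by absolute continuity. *)
Lemma abs_continuous_ae_derive_le0 (R : realType) (T : R) (f : R -> R) :
  0 <= T -> abs_continuous 0 T f ->
  {ae @lebesgue_measure R, forall t, 0 < t < T ->
    exists2 l, is_derive t (1 : R) f l & l <= 0} ->
  f T <= f 0.
Proof.
move=> T0 acf [N [mN N0 subN]].
rewrite -subr_le0; apply/ler_addgt0Pl => e' e'0; rewrite addr0.
(* The tolerance [e'] is shared out: [e * T] for the slopes off [U], and [e] for the intervals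
   collected in [U]. *)
pose e := e' / (T + 1).
have T1 : 0 < T + 1 by lra.
have e0 : 0 < e by rewrite divr_gt0.
have eE : e' = e * T + e by rewrite /e -{2}(mulr1 (e' / _)) -mulrDr mulfVK ?gt_eqF.
have [delta delta0 Hdelta] := acf e e0.
set mu := @lebesgue_measure R in N0.
(* No derivative is assumed at the two end points, so they are treated like the exceptional null set
   and covered by [U]. *)
pose D := N `|` ([set 0] `|` [set T]).
have mD : measurable D by apply: measurableU => //; apply: measurableU => //;
  exact: measurable_set1.
have mu1 x : mu [set x] = 0%E by exact: lebesgue_measure_set1.
have muD : mu D = 0%E.
  apply/eqP; rewrite eq_le measure_ge0 andbT.
  apply: (le_trans (measureU2 _ _ _)) => //; first by apply: measurableU => //;
    exact: measurable_set1.
  rewrite [X in (X + _)%E]N0 add0e; apply: (le_trans (measureU2 _ _ _));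
    [exact: measurable_set1..|].
  by rewrite [X in (X + _)%E]mu1 [X in (_ + X)%E]mu1 adde0.
have [|U [oU DU muU]] := @lebesgue_regularity_outer R D delta mD _ delta0.
  by rewrite -/mu [X in (X < _)%E]muD ltry.
have mU : measurable U by exact: measurable_realfun.open_measurable.
have {}muU : (mu U < delta%:E)%E.
  apply: le_lt_trans muU; rewrite -(setDUK DU).
  apply: (le_trans (measureU2 _ _ _)) => //; first exact: measurableD.
  by rewrite [X in (X + _)%E]muD add0e setDUK.
pose W t := U `&` `[0, t[.
have mW t : measurable (W t) by apply: measurableI => //; exact: measurable_itv.
(* The total length is bounded by [mu (W t)] rather than by [delta]: this bound is additive when an
   interval [[x, y[] contained in [U] is appended, and it stays below [delta] because [W t] lies in
   [U]. *)
pose S t := 0 <= t <= T /\ exists n (I : 'I_n -> R * R),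
  [/\ forall i, 0 <= (I i).1 /\ (I i).1 <= (I i).2 /\ (I i).2 <= t,
      forall i j, i != j -> (I i).2 <= (I j).1 \/ (I j).2 <= (I i).1,
      ((\sum_i ((I i).2 - (I i).1))%:E <= mu (W t))%E &
      f t - f 0 <= e * t + \sum_i `|f (I i).2 - f (I i).1|].
have S0 : S 0.
  split; first by rewrite lexx.
  exists 0%N, (fun=> (0, 0)); split; try by case.
    by rewrite big_ord0 measure_ge0.
  by rewrite big_ord0 subrr mulr0 addr0.
have Sle t : S t -> f t - f 0 <= e * t + e.
  move=> [/andP[t0 tT] [n [I [I1 I2 I3 I4]]]].
  apply: (le_trans I4); rewrite lerD2l; apply/ltW/Hdelta => //.
    by move=> i; have [? []] := I1 i; do !split => //; lra.
  rewrite -lte_fin; apply: (le_lt_trans I3); apply: le_lt_trans muU.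
  by apply: le_measure; rewrite ?inE //; [exact: mW|exact: subIsetl].
(* Passing from [x] on the left of [s] to [y] on its right covers both halves of the induction:
   [sup S] is approached from the left by points of [S], and [y] may be [s] itself or lie beyond
   it. *)
have step s : 0 <= s <= T -> exists2 eta, 0 < eta & forall x y,
    S x -> s - eta < x -> x <= s -> s <= y -> y < s + eta -> y <= T -> S y.
  move=> /andP[s0 sT]; have [Ds|nDs] := pselect (D s).
    have /nbhs_ballP[eta /= eta0 Heta] : nbhs s U by apply: open_nbhs_nbhs; split => //;
      exact: DU.
    exists eta => // x y [/andP[x0 xT] [n [I [I1 I2 I3 I4]]]] sx xs sy ys yT.
    split; first by lra.
    exists n.+1, (fun i => if unlift ord_max i is Some j then I j else (x, y)).
    have liftE (j : 'I_n) : unlift ord_max (widen_ord (leqnSn n) j) = Some j.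
      have -> : widen_ord (leqnSn n) j = lift ord_max j by apply: val_inj;
        exact/esym/lift_max.
      by rewrite liftK.
    split.
    - move=> i; case: unliftP => [j _|_] /=; last by lra.
      by have := I1 j; lra.
    - move=> i j; case: unliftP => [i' ->|->]; case: unliftP => [j' ->|->] //=.
      + by rewrite (inj_eq lift_inj); exact: I2.
      + by move=> _; left; have := I1 i'; lra.
      + by move=> _; right; have := I1 j'; lra.
      + by rewrite eqxx.
    - rewrite big_ord_recr/= unlift_none/= EFinD.
      under eq_bigr do rewrite liftE.
      apply: (@le_trans _ _ (mu (W x) + mu `[x, y[%classic)%E).
        apply: leeD => //; rewrite /mu lebesgue_measure_itv/= lte_fin.
        case: ltP => [_|xy]; first by rewrite EFinB.
        by rewrite lee_fin; lra.
      have disj : W x `&` `[x, y[ = set0.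
        rewrite -subset0 => z [[_ /=]]; rewrite !in_itv/= => /andP[_ zx] /andP[xz _].
        by move: (lt_le_trans zx xz); rewrite ltxx.
      rewrite -(measureU mu (mW x) (measurable_itv _) disj).
      apply: le_measure; rewrite ?inE//.
      + by apply: measurableU; [exact: mW|exact: measurable_itv].
      + exact: mW.
      move=> z [[Uz]|] /=; rewrite !in_itv/= => /andP[z1 z2].
        by split => //=; rewrite in_itv/= z1/=; lra.
      split; last by rewrite /= in_itv/=; apply/andP; split; lra.
      by apply: Heta; rewrite /ball/= ltr_norml; apply/andP; split; lra.
    - rewrite big_ord_recr/= unlift_none/=.
      under eq_bigr do rewrite liftE.
      have := ler_norm (f y - f x).
      have : e * x <= e * y by rewrite ler_pM2l//; lra.
      by move: I4; lra.
  have [l dl l0] : exists2 l, is_derive s 1 f l & l <= 0.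
    have : ~ N s by move=> Ns; apply: nDs; left.
    move=> /(contra_not (@subN s))/contrapT; apply.
    rewrite !lt_neqAle s0 sT !andbT; apply/andP; split; apply/eqP => sE; apply: nDs; right.
      by left; rewrite sE.
    by right; rewrite sE.
  have [eta eta0 Heta] := is_derive_slope dl (le_lt_trans l0 e0).
  exists eta => // x y [/andP[x0 xT] [n [I [I1 I2 I3 I4]]]] sx xs sy ys yT.
  split; first by lra.
  exists n, I; split => //.
  - by move=> i; have := I1 i; lra.
  - apply: (le_trans I3); apply: le_measure; rewrite ?inE.
    + exact: mW.
    + exact: mW.
    move=> z [Uz /=]; rewrite !in_itv/= => /andP[z1 z2].
    by split => //=; rewrite in_itv/= z1/=; lra.
  - have := Heta x y sx xs sy ys; move: I4.
    by rewrite mulrBr; lra.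
have hsS : has_sup S by split; [exists 0|exists T => t [/andP[]]].
have s0 : 0 <= sup S by apply: ub_le_sup => //; case: hsS.
have sT : sup S <= T by apply: ge_sup; [exists 0|move=> t [/andP[]]].
have s0T : 0 <= sup S <= T by rewrite s0 sT.
have [eta eta0 Heta] := step _ s0T.
have [x Sx xs] := sup_adherent eta0 hsS.
have xsup : x <= sup S by apply: ub_le_sup => //; case: hsS.
have [sT'|Ts] := ltP (sup S) T; last first.
  rewrite eE; apply: Sle; apply: (Heta x) => //; lra.
pose y := Num.min T (sup S + eta / 2).
have yT : y <= T by rewrite ge_min lexx.
have ye : y <= sup S + eta / 2 by rewrite ge_min lexx orbT.
have sy : sup S < y by rewrite lt_min sT'/=; lra.
have Sy : S y by apply: (Heta x) => //; lra.
have : y <= sup S by apply: ub_le_sup => //; case: hsS.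
by rewrite leNgt sy.
Qed.

Lemma abs_continuous_itvW (R : realType) (a b c d : R) (f : R -> R) :
  a <= c -> d <= b -> abs_continuous a b f -> abs_continuous c d f.
Proof.
move=> ac db acf e /acf[delta delta0 H]; exists delta => // n I I1.
by apply: H => i; have := I1 i; lra.
Qed.

Lemma abs_continuousB (R : realType) (a b : R) (f g : R -> R) :
  abs_continuous a b f -> abs_continuous a b g ->
  abs_continuous a b (fun x => f x - g x).
Proof.
move=> acf acg e e0; have e20 : 0 < e / 2 by rewrite divr_gt0.
have [d1 d10 H1] := acf _ e20; have [d2 d20 H2] := acg _ e20.
exists (Num.min d1 d2); first by rewrite lt_min d10.
move=> n I I1 I2; rewrite lt_min => /andP[/(H1 n I I1 I2) + /(H2 n I I1 I2)].
have : \sum_i `|f (I i).2 - g (I i).2 - (f (I i).1 - g (I i).1)| <=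
    \sum_i `|f (I i).2 - f (I i).1| + \sum_i `|g (I i).2 - g (I i).1|.
  rewrite -big_split/=; apply: ler_sum => i _.
  apply: le_trans (ler_normB _ _); rewrite le_eqVlt; apply/orP; left; apply/eqP.
  by congr (`|_|); ring.
by lra.
Qed.

Lemma bounded_derive_abs_continuous (R : realType) (a b L : R) (f df : R -> R) :
  {within `[a, b], continuous f} ->
  (forall t, a < t < b -> is_derive t (1 : R) f (df t)) ->
  (forall t, a <= t <= b -> `|df t| <= L) -> abs_continuous a b f.
Proof.
move=> cf ddf Ldf e e0.
have L1 : 0 < `|L| + 1 by rewrite ltr_wpDl.
exists (e / (`|L| + 1)); first by rewrite divr_gt0.
move=> n I I1 I2; rewrite ltr_pdivlMr// mulrC mulr_sumr; apply: le_lt_trans.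
apply: ler_sum => i _; have [aI [II Ib]] := I1 i.
have [|//||c] := @MVT_segment R f df (I i).1 (I i).2 => //.
- by move=> x; rewrite in_itv/= => ?; apply: ddf; lra.
- by apply: continuous_subspaceW cf; by apply: subset_itvScc; rewrite bnd_simp.
rewrite in_itv/= => cI ->; rewrite normrM.
have -> : `|(I i).2 - (I i).1| = (I i).2 - (I i).1 by rewrite ger0_norm// subr_ge0.
apply: ler_wpM2r; first by rewrite subr_ge0.
have : `|df c| <= L by apply: Ldf; lra.
by have := ler_norm L; lra.
Qed.

Lemma is_derive_expRM (R : realType) (lam t : R) :
  is_derive t (1 : R) (fun x => expR (lam * x)) (lam * expR (lam * t)).
Proof.
have -> : (fun x => expR (lam * x)) = expR \o ( *%R lam) by [].
rewrite mulrC; apply: (@is_derive1_comp R expR ( *%R lam) t (expR (lam * t)) lam).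
have -> : ( *%R lam) = lam \*: (@id R) by apply/funext.
by apply: is_derive_eq; rewrite /GRing.scale/= mulr1.
Qed.

Lemma expRM_abs_continuous (R : realType) (c lam T : R) : 0 <= lam -> 0 <= T ->
  abs_continuous 0 T (fun x => c * expR (lam * x)).
Proof.
move=> lam0 T0.
have dE t : is_derive t (1 : R) (fun x => c * expR (lam * x)) (c * (lam * expR (lam * t))).
  have -> : (fun x => c * expR (lam * x)) = c \*: (fun x => expR (lam * x)) by [].
  exact: (@is_deriveZ R R R^o (fun x => expR (lam * x)) c t 1 _ (is_derive_expRM lam t)).
apply: (@bounded_derive_abs_continuous R 0 T (`|c| * (lam * expR (lam * T))) _
  (fun t => c * (lam * expR (lam * t)))) => //.
  apply: continuous_subspaceT => x; apply: differentiable_continuous.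
  by apply/derivable1_diffP; have [] := dE x.
move=> t /andP[t0 tT]; rewrite normrM ler_wpM2l// ger0_norm ?mulr_ge0 ?expR_ge0//.
by rewrite ler_wpM2l// ler_expR ler_wpM2l.
Qed.

Lemma ae_derive_le_expR (R : realType) (T C lam : R) (f : R -> R) :
  0 < lam -> 0 <= C -> abs_continuous 0 T f ->
  {ae @lebesgue_measure R, forall t, 0 < t < T ->
    exists2 l, is_derive t (1 : R) f l & l <= C * expR (lam * t)} ->
  forall t, 0 <= t <= T -> f t - f 0 <= C / lam * expR (lam * t).
Proof.
move=> lam0 C0 acf df t /andP[t0 tT].
have : f t - C / lam * expR (lam * t) <= f 0 - C / lam * expR (lam * 0).
  apply: (@abs_continuous_ae_derive_le0 R t (fun x => f x - C / lam * expR (lam * x))) =>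
    //.
    apply: abs_continuousB; first exact: abs_continuous_itvW acf.
    by apply: expRM_abs_continuous => //; exact: ltW.
  have aeF := ae_filter_ringOfSetsType (@lebesgue_measure R);
    apply: filterS df => x dfx /andP[x0 xt].
  have [|l dl lC] := dfx; first by rewrite x0 (lt_le_trans xt).
  exists (l - C * expR (lam * x)); last by rewrite subr_le0.
  have dE := @is_deriveZ R R R^o _ (C / lam) x 1 _ (is_derive_expRM lam x).
  have := is_deriveB dl dE; congr is_derive.
  by rewrite /GRing.scale/= mulrA divfK ?gt_eqF.
have : 0 <= C / lam * expR (lam * 0) by rewrite mulr_ge0 ?expR_ge0// divr_ge0// ltW.
lra.
Qed.

Lemma abs_continuous_growth (R : realType) (T C lam : R) (f : R -> R) :
  0 < lam -> 0 <= C -> f 0 = 0 -> abs_continuous 0 T f ->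
  {ae @lebesgue_measure R, forall t, 0 < t < T ->
    exists2 l, is_derive t (1 : R) f l & `|l| <= C * expR (lam * t)} ->
  forall t, 0 <= t <= T -> `|f t| <= C / lam * expR (lam * t).
Proof.
move=> lam0 C0 f0 acf df t tT; rewrite ler_norml; apply/andP; split; last first.
  rewrite -[f t]subr0 -f0; apply: (@ae_derive_le_expR R T) => //.
  have aeF := ae_filter_ringOfSetsType (@lebesgue_measure R);
    apply: filterS df => x dfx /dfx[l dl lC]; exists l => //.
  by rewrite (le_trans _ lC)// ler_norm.
rewrite lerNl; have -> : - f t = - f t - - f 0 by rewrite f0 oppr0 subr0.
apply: (@ae_derive_le_expR R T C lam (fun x => - f x)) => //.
  move=> e /acf[d d0 H]; exists d => // n I I1 I2 I3.
  have := H n I I1 I2 I3; under eq_bigr do rewrite distrC.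
  by under [X in _ -> X < _]eq_bigr do rewrite opprK addrC.
have aeF := ae_filter_ringOfSetsType (@lebesgue_measure R);
  apply: filterS df => x dfx /dfx[l dl lC]; exists (- l); first exact: is_deriveN.
by rewrite (le_trans _ lC)// -normrN ler_norm.
Qed.

(* y is in W^{2,1}(0, T), with first and second derivatives y1 and y2. *)
Definition twice_weakly_derivable (R : realType) (T : R) (y y1 y2 : R -> R) : Prop :=
  [/\ {within `[0, T], continuous y},
      forall t, 0 < t < T -> is_derive t (1 : R) y (y1 t),
      abs_continuous 0 T y1 &
      {ae @lebesgue_measure R, forall t, 0 < t < T -> is_derive t (1 : R) y1 (y2 t)}].

Lemma twice_weakly_derivableB (R : realType) (T : R) (y y1 y2 z z1 z2 : R -> R) :
  twice_weakly_derivable T y y1 y2 -> twice_weakly_derivable T z z1 z2 ->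
  twice_weakly_derivable T (fun t => y t - z t) (fun t => y1 t - z1 t)
    (fun t => y2 t - z2 t).
Proof.
move=> [cy dy acy dy1] [cz dz acz dz1]; split.
- move=> x; exact: (@continuousB R R^o (subspace `[0, T]) y z x (cy x) (cz x)).
- by move=> t tT; exact: is_deriveB (dy t tT) (dz t tT).
- exact: abs_continuousB.
- have aeF := ae_filter_ringOfSetsType (@lebesgue_measure R).
  by apply: filterS2 dy1 dz1 => t Hy Hz tT; exact: is_deriveB (Hy tT) (Hz tT).
Qed.

(** Two uses of [abs_continuous_growth], each worth a factor [1 / lam]. The bound on [y1] obtained
    from the first makes [y] Lipschitz, hence absolutely continuous, as the second requires. *)
Lemma twice_weakly_derivable_growth (R : realType) (T C lam : R) (y y1 y2 : R -> R) :
  0 < lam -> 0 <= C -> twice_weakly_derivable T y y1 y2 -> y 0 = 0 -> y1 0 = 0 ->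
  {ae @lebesgue_measure R, forall t, 0 < t < T -> `|y2 t| <= C * expR (lam * t)} ->
  forall t, 0 <= t <= T -> `|y t| <= C / lam ^+ 2 * expR (lam * t).
Proof.
move=> lam0 C0 [cy dy ac1 dy1] y0 y10 yC t tT.
have y1C s : 0 <= s <= T -> `|y1 s| <= C / lam * expR (lam * s).
  apply: abs_continuous_growth => //.
  have aeF := ae_filter_ringOfSetsType (@lebesgue_measure R).
  by apply: filterS2 dy1 yC => x dx yx xT; exists (y2 x); [exact: dx|exact: yx].
have -> : C / lam ^+ 2 = C / lam / lam by rewrite expr2 invfM mulrA.
have Cl : 0 <= C / lam by rewrite divr_ge0// ltW.
apply: (@abs_continuous_growth R T) => //.
  apply: (@bounded_derive_abs_continuous R 0 T (C / lam * expR (lam * T)) y y1) => //.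
  move=> s /[dup] sT /y1C /le_trans; apply; rewrite ler_wpM2l// ler_expR ler_wpM2l//.
    exact: ltW.
  by case/andP: sT.
apply: aeW => s sT; exists (y1 s); [exact: dy|apply: y1C; lra].
Qed.

(** * Primitives of integrable functions *)

Lemma integral_abs_continuous (R : realType) (a b : R) (h : R -> R) :
  0 <= a -> (@lebesgue_measure R).-integrable setT (EFin \o h) ->
  abs_continuous a b (fun t => \int[@lebesgue_measure R]_(s in `[0, t]) h s).
Proof.
move=> a0 ih e e0.
have [d [d0 H]] := integral_normr_continuous ih e0.
have ihS (A : set R) : measurable A -> (@lebesgue_measure R).-integrable A (EFin \o h).
  by move=> mA; exact: integrableS ih.
exists d => // n I I1 I2 Id.
(* The given intervals may share end points; dropping the left ones makes them disjoint without
   changing their lengths. *)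
pose F i := `](I i).1, (I i).2]%classic.
have mF i : measurable (F i) by exact: measurable_itv.
have tF : trivIset setT F.
  apply/trivIsetP => i j _ _ ij; rewrite -subset0 => x []; rewrite /F /= !in_itv/=.
  by case: (I2 _ _ ij) => ? ?; lra.
have muF i : @lebesgue_measure R (F i) = ((I i).2 - (I i).1)%:E.
  rewrite lebesgue_measure_itv/= lte_fin; case: ltP => [_|?]; first by rewrite EFinB.
  by apply/eqP; rewrite eqe; apply/eqP; have := I1 i; lra.
pose D := \big[setU/set0]_(i < n) F i.
have mD : measurable D by exact: bigsetU_measurable.
have := H D mD; rewrite /D measure_bigsetU_ord// => /(_ _) HD.
have {}HD : \int[@lebesgue_measure R]_(x in D) `|h x| < e.
  apply: HD; apply: le_lt_trans (_ : ((\sum_(i < n) ((I i).2 - (I i).1))%:E < _)%E).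
    by rewrite -sumEFin; apply: lee_sum => i _; rewrite -muF.
  by rewrite lte_fin.
apply: le_lt_trans HD.
have -> : \int[@lebesgue_measure R]_(x in D) `|h x| =
    \sum_(i < n) \int[@lebesgue_measure R]_(x in F i) `|h x|.
  have inh : (@lebesgue_measure R).-integrable setT (EFin \o (fun x => `|h x|)).
    by have := integrable_abse ih; apply: eq_integrable.
  rewrite /Rintegral integral_bigsetU_EFin//=; last 3 first.
  - exact: index_enum_uniq.
  - by apply: sub_trivIset tF.
  - by case/integrableP: inh => + _; exact: measurable_funS.
  rewrite -sum_fine// => i _.
  apply: integrable_fin_num; [exact: mF|].
  by apply: (integrableS _ _ _ inh) => //; exact: mF.
apply: ler_sum => i _; have [aI [II Ib]] := I1 i.
have I10 : 0 <= (I i).1 by lra.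
rewrite (_ : _ - _ = \int[@lebesgue_measure R]_(x in F i) h x).
  by apply: le_normr_Rintegral; [exact: mF|apply: ihS; exact: mF].
by rewrite Rintegral_itvB ?bnd_simp//; exact: ihS.
Qed.

(** [h] is integrated twice. The first primitive is continuous, so the second is differentiable at
    every interior point, whereas the first has derivative [h] only almost everywhere, by Lebesgue
    differentiation. *)
Lemma ex_twice_weakly_derivable (R : realType) (T a b : R) (h : R -> R) :
  0 < T -> (@lebesgue_measure R).-integrable `]0, T[ (EFin \o h) ->
  exists y y1, [/\ twice_weakly_derivable T y y1 h, y 0 = a & y1 0 = b].
Proof.
move=> T0 ih; set mu := @lebesgue_measure R in ih.
pose h0 := h \_ `]0, T[.
have ih0 : mu.-integrable setT (EFin \o h0).
  rewrite /h0 -restrict_EFin.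
  by apply/integrable_restrict => //; rewrite ?setTI.
pose H t := \int[mu]_(s in `[0, t]) h0 s.
pose y1 t := b + H t.
have cH : {within `[0, T], continuous H}.
  by apply: parameterized_integral_continuous; [exact: ltW|exact: integrableS ih0].
have cy1 : {within `[0, T], continuous y1}.
  move=> x; apply: (@continuousD R R^o (subspace `[0, T]) (fun=> b) H x _ (cH x)).
  exact: cst_continuous.
have iy1 : mu.-integrable `[0, T] (EFin \o y1).
  by apply: continuous_compact_integrable => //; exact: segment_compact.
pose Y t := \int[mu]_(s in `[0, t]) y1 s.
have cY : {within `[0, T], continuous Y}.
  by apply: parameterized_integral_continuous => //; exact: ltW.
exists (fun t => a + Y t), y1; split; last 2 first.
- by rewrite /Y set_itv1 Rintegral_set1 addr0.
- by rewrite /y1 /H set_itv1 Rintegral_set1 addr0.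
split.
- move=> x; apply: (@continuousD R R^o (subspace `[0, T]) (fun=> a) Y x _ (cY x)).
  exact: cst_continuous.
- move=> t /andP[t0 tT].
  have [] := @continuous_FTC1_closed R y1 0 t T tT iy1 t0.
    move/(continuous_within_itvP _ T0) : cy1 => [+ _ _]; apply.
    by rewrite in_itv/= t0.
  rewrite -/Y => dY dYE; rewrite -[y1 t]add0r; apply: is_deriveD.
  by apply: DeriveDef; [exact: dY|rewrite -derive1E; exact: dYE].
- move=> e e0; have [d d0 Hd] := integral_abs_continuous T (lexx 0) ih0 e0.
  exists d => // n I I1 I2 I3; have := Hd n I I1 I2 I3.
  congr (_ < _); apply: eq_bigr => i _; congr `|_|; rewrite /y1 /H; ring.
- have loch : locally_integrable setT h0.
    by apply: open_integrable_locally => //; exact: openT.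
  have ih0y (y : R) : mu.-integrable `[0, y] (EFin \o h0) by exact: integrableS ih0.
  have := @FTC1 R h0 (BLeft 0) ih0y loch.
  have aeF := ae_filter_ringOfSetsType (@lebesgue_measure R).
  apply: filterS => t Ht /andP[t0 tT].
  have [|dH dHE] := Ht; first exact: t0.
  rewrite -[h t]add0r; apply: is_deriveD; apply: DeriveDef => //.
  rewrite -derive1E dHE /h0 patchE mem_set//=.
  by rewrite in_itv/= t0.
Qed.

(** * Convolution with an integrable kernel *)

(** By uniqueness of Lebesgue measure it is enough to compare lengths of half-open intervals and of
    their reflections. *)
Lemma lebesgue_measure_subl (R : realType) (t : R) (A : set R) : measurable A ->
  pushforward (@lebesgue_measure R) (fun s : R => t - s : measurableTypeR R) A =
  @lebesgue_measure R A.
Proof.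
have mf : measurable_fun setT (fun s : R => t - s : measurableTypeR R).
  exact: measurable_funB.
move=> mA.
pose mf_mixin := isMeasurableFun.Build _ _ _ _ _ mf.
pose f : {mfun _ >-> _} := HB.pack (fun s : R => t - s : measurableTypeR R) mf_mixin.
apply/esym/(@lebesgue_measure_unique R (pushforward (@lebesgue_measure R) f)) => //.
move=> _ [[a b] /= _ <-]; rewrite /pushforward.
have -> : (fun s : R => t - s) @^-1` `]a, b] = `[t - b, t - a[%classic.
  by apply/seteqP; split => s /=; rewrite !in_itv/= => /andP[? ?]; apply/andP; split; lra.
rewrite !lebesgue_measure_itv/= !lte_fin -!EFinB.
have -> : (t - b < t - a) = (a < b) by apply/idP/idP; lra.
by congr (if _ then _%:E else _); ring.
Qed.

Lemma ge0_integral_subl (R : realType) (t : R) (f : R -> \bar R) :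
  measurable_fun setT (f : measurableTypeR R -> \bar R) -> (forall x, (0 <= f x)%E) ->
  (\int[@lebesgue_measure R]_s f (t - s)%R = \int[@lebesgue_measure R]_s f s)%E.
Proof.
move=> mf f0.
have mt : measurable_fun setT (fun s : measurableTypeR R => t - s : measurableTypeR R).
  exact: measurable_funB.
have := @ge0_integral_pushforward _ _ (measurableTypeR R) (measurableTypeR R) R _ mt
  (@lebesgue_measure R) setT f measurableT mf
  (fun y _ => f0 y).
rewrite preimage_setT => <-.
by apply: eq_measure_integral => A mA _; exact: lebesgue_measure_subl.
Qed.

Section convolution.
Context (R : realType).
Local Notation mu := (@lebesgue_measure R).
Variables k h : R -> R.
Hypothesis ik : mu.-integrable setT (EFin \o k).
Hypothesis mh : measurable_fun setT h.

Let mk : measurable_fun setT k.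
Proof. by case/integrableP: ik => /measurable_EFinP. Qed.

Let mkn : measurable_fun setT (fun s => `|k s|).
Proof. exact: measurableT_comp mk. Qed.

Let mkt t : measurable_fun setT (fun s : R => k (t - s)).
Proof. by apply: (measurableT_comp mk); exact: measurable_funB. Qed.

Lemma integrable_subl t : mu.-integrable setT (EFin \o (fun s : R => k (t - s))).
Proof.
apply/integrableP; split; first by apply/measurable_EFinP; exact: mkt.
have := @ge0_integral_subl R t (fun s => `|(k s)%:E|%E) _ (fun=> abse_ge0 _).
move=> /= ->; first by case/integrableP: ik.
by apply/measurable_EFinP; exact: mkn.
Qed.

Lemma Rintegral_normr_subl t : \int[mu]_s `|k (t - s)| = \int[mu]_s `|k s|.
Proof.
rewrite /Rintegral; congr fine.
apply: (@ge0_integral_subl R t (fun s => (`|k s|)%:E)) => //.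
by apply/measurable_EFinP; exact: mkn.
Qed.

Variable C : R.
Hypothesis hC : forall s, `|h s| <= C.

Lemma integrable_convolution t :
  mu.-integrable setT (EFin \o (fun s : R => k (t - s) * h s)).
Proof.
have C0 : 0 <= C by apply: le_trans (hC 0).
have := integrable_subl t.
move=> /(integrableZl measurableT C) ikC; apply: le_integrable ikC => //.
  by apply/measurable_EFinP; apply: measurable_funM => //; exact: mkt.
move=> x _ /=; rewrite lee_fin !normrM mulrC; apply: ler_wpM2r => //.
by rewrite (le_trans (hC x))// ler_norm.
Qed.

(** Fubini's theorem on the plane supplies measurability in t as well as integrability. The
    indicator of []0, T[] is put into the integrand because the inner integrals have only the
    constant bound [C * \int |k|], which is integrable on a bounded interval. *)
Lemma convolution_integrable T : mu.-integrable `]0, T[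
  (EFin \o (fun t => \int[mu]_s (k (t - s) * h s))).
Proof.
have C0 : 0 <= C by apply: le_trans (hC 0).
pose f (p : R * R) := (\1_(`]0, T[%classic) p.1 * (k (p.1 - p.2) * h p.2))%:E.
have mf : measurable_fun setT f.
  apply/measurable_EFinP; apply: measurable_funM.
    by apply: measurableT_comp => //; exact: measurable_indic.
  apply: measurable_funM; last exact: measurableT_comp.
  by apply: (measurableT_comp mk); exact: measurable_funB.
have intf : (mu \x mu)%E.-integrable setT f.
  apply/integrable12ltyP => //.
  pose B : R := C * \int[mu]_s `|k s|.
  apply: (@le_lt_trans _ _ (\int[mu]_(t in `]0%R, T[) B%:E)%E); last first.
    rewrite integral_cst//= lebesgue_measure_itv/=.
    by case: ifP => _; rewrite -?EFinB -?EFinM ?mule0 ltry.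
  rewrite [leRHS]integral_mkcond.
  apply: ge0_le_integral => //.
  - by move=> x _; exact: integral_ge0.
  - apply: (@measurable_fun_fubini_tonelli_F _ _ _ _ R mu (abse \o f)) => //.
    exact: measurableT_comp.
    by move=> z; rewrite /= lee_fin.
  - apply: ((@measurable_restrictT _ _ _ _ (`]0, T[%classic :
    set R) (cst B%:E) (measurable_itv _)).1 _).
    exact: measurable_cst.
  move=> t _; rewrite patchE /f /= indicE; case: ifPn => tT.
    have ikn : mu.-integrable setT (EFin \o (fun s : R => C * `|k (t - s)|)).
      by have := integrableZl measurableT C (integrable_abse (integrable_subl t));
        apply: eq_integrable.
    rewrite /B -(Rintegral_normr_subl t) -RintegralZl//; last first.
      by have := integrable_abse (integrable_subl t); apply: eq_integrable.
    rewrite /Rintegral fineK; last exact: integrable_fin_num.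
    apply: ge0_le_integral => //.
    - apply/measurable_EFinP; apply: measurableT_comp => //.
      by apply: measurable_funM => //; apply: measurable_funM => //; exact: mkt.
    - by case/integrableP: ikn.
    move=> s _; rewrite mul1r lee_fin normrM mulrC.
    by apply: ler_wpM2r.
  under eq_integral do rewrite mul0r normr0.
  by rewrite integral0.
have := integrable_fubini_F intf.
move=> /(@integrableS _ _ _ mu setT `]0, T[%classic _ measurableT (measurable_itv _)
  (@subsetT _ _)).
apply: eq_integrable => // t tT.
rewrite /fubini_F /f /= indicE tT /=.
under eq_integral do rewrite mul1r.
rewrite /Rintegral fineK//.
by apply: integrable_fin_num => //; exact: integrable_convolution.
Qed.

(** Since [k] vanishes on nonpositive arguments, only s < t contributes, and there the weight
    [expR (lam * s)] is at most [expR (lam * t)], which leaves the integral. *)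
Lemma norm_convolution_le (lam D t : R) : 0 <= lam -> 0 <= D ->
  (forall x, x <= 0 -> k x = 0) ->
  (forall s, s <= t -> `|h s| <= D * expR (lam * s)) ->
  `|\int[mu]_s (k (t - s) * h s)| <= D * expR (lam * t) * \int[mu]_s `|k s|.
Proof.
move=> lam0 D0 k0 hD; apply: (le_trans (le_normr_Rintegral _ _)) => //.
  exact: integrable_convolution.
rewrite -(Rintegral_normr_subl t).
have ikn : mu.-integrable setT (EFin \o (fun s : R => `|k (t - s)|)).
  by have := integrable_abse (integrable_subl t); apply: eq_integrable.
rewrite -RintegralZl//; apply: le_Rintegral => //.
- by have := integrable_abse (integrable_convolution t); apply: eq_integrable.
- by have := integrableZl measurableT (D * expR (lam * t)) ikn; apply: eq_integrable.
move=> s _; rewrite normrM mulrC; have [st|ts] := leP s t.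
  apply: ler_wpM2r => //; apply: (le_trans (hD _ st)).
  by rewrite ler_wpM2l// ler_expR ler_wpM2l.
by rewrite k0 ?normr0 ?mulr0// subr_le0 ltW.
Qed.

End convolution.

(** * The memory term as a convolution on the whole line *)

Section volterra.
Context (R : realType).
Local Notation mu := (@lebesgue_measure R).

Definition volterra (K h : R -> R) (t : R) : R :=
  \int[mu]_(s in `[0, t]) (K (t - s) * h s).

Variables (T : R) (K : R -> R).
Hypothesis T0 : 0 < T.
Hypothesis iK : mu.-integrable `]0, T[ (EFin \o K).

Let K0 := K \_ `]0, T[.

Let iK0 : mu.-integrable setT (EFin \o K0).
Proof.
rewrite /K0 -restrict_EFin.
by apply/integrable_restrict => //; rewrite ?setTI.
Qed.

Let K0_le0 (x : R) : x <= 0 -> K0 x = 0.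
Proof. by move=> x0; rewrite /K0 patchE memNset//= in_itv/= ltNge x0. Qed.

Let Rintegral_normr_K0 : \int[mu]_s `|K0 s| = \int[mu]_(s in `]0, T[) `|K s|.
Proof.
rewrite [RHS]Rintegral_mkcond; apply: eq_Rintegral => s _.
by rewrite /K0 !patchE; case: ifP => //; rewrite normr0.
Qed.

Let mh0 (h : R -> R) : {within `[0, T], continuous h} -> measurable_fun setT (h \_ `[0, T]).
Proof.
move=> ch; apply/(measurable_restrictT _ _).1; first exact: measurable_itv.
by apply: subspace_continuous_measurable_fun => //; exact: measurable_itv.
Qed.

Let h0_bounded (h : R -> R) : {within `[0, T], continuous h} ->
  exists C, forall s, `|(h \_ `[0, T]) s| <= C.
Proof.
move=> ch.
have cn : {within `[0, T], continuous (fun x => `|h x|)}.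
  by move=> x; apply: continuous_comp; [exact: ch|exact: norm_continuous].
have [c _ Hc] := EVT_max (ltW T0) cn.
exists `|h c| => s; rewrite patchE; case: ifPn => [|_]; last by rewrite normr0.
by rewrite inE/= => /Hc.
Qed.

(** Extension by zero replaces the moving domain of integration by the line: the zeros of [K0] cut
    off s >= t and those of the extended [h] cut off s < 0. *)
Let volterraE (h : R -> R) (t : R) : {within `[0, T], continuous h} -> 0 < t < T ->
  volterra K h t = \int[mu]_s (K0 (t - s) * (h \_ `[0, T]) s).
Proof.
move=> ch /andP[t0 tT]; have [C hC] := h0_bounded ch.
have ic := integrable_convolution iK0 (mh0 ch) hC t.
have E s : s \in `[0, t[%classic -> K (t - s) * h s = K0 (t - s) * (h \_ `[0, T]) s.
  rewrite inE/= in_itv/= => /andP[s0 st]; rewrite /K0 !patchE !mem_set//= in_itv/=.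
    by rewrite s0/=; lra.
  by apply/andP; split; lra.
(* The point s = t is removed first, since there [K0] is 0 while [K 0] is arbitrary. *)
rewrite /volterra -Rintegral_itv_bndo_bndc; last first.
  apply: eq_integrable (_ : mu.-integrable `[0, t[ (EFin \o (fun s : R =>
    K0 (t - s) * (h \_ `[0, T]) s))) => //.
    by move=> s st /=; rewrite E.
  exact: integrableS ic.
transitivity (\int[mu]_(s in `[0, t[) (K0 (t - s) * (h \_ `[0, T]) s)).
  exact: eq_Rintegral.
rewrite Rintegral_mkcond; apply: eq_Rintegral => s _.
rewrite patchE; case: ifPn => //; rewrite notin_setE/= in_itv/= => /negP.
rewrite negb_and -ltNge -leNgt => /orP[s0|ts].
  by rewrite [(h \_ _) s]patchE memNset ?mulr0//= in_itv/= leNgt s0.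
by rewrite K0_le0 ?mul0r// subr_le0.
Qed.

Lemma volterra_integrable (h : R -> R) : {within `[0, T], continuous h} ->
  mu.-integrable `]0, T[ (EFin \o volterra K h).
Proof.
move=> ch; have [C hC] := h0_bounded ch.
have := convolution_integrable iK0 (mh0 ch) hC T.
apply: eq_integrable => // t; rewrite inE/= in_itv/= => tT.
by rewrite volterraE.
Qed.

Lemma volterra_dist_le (h1 h2 : R -> R) (lam D t : R) :
  {within `[0, T], continuous h1} -> {within `[0, T], continuous h2} ->
  0 <= lam -> 0 <= D ->
  (forall s, 0 <= s <= T -> `|h1 s - h2 s| <= D * expR (lam * s)) -> 0 < t < T ->
  `|volterra K h1 t - volterra K h2 t| <=
    D * expR (lam * t) * \int[mu]_(s in `]0, T[) `|K s|.
Proof.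
move=> ch1 ch2 lam0 D0 hD tT; rewrite !volterraE// -Rintegral_normr_K0.
have [C1 hC1] := h0_bounded ch1; have [C2 hC2] := h0_bounded ch2.
rewrite -RintegralB//; [|exact: (integrable_convolution iK0 (mh0 ch1) hC1)
                        |exact: (integrable_convolution iK0 (mh0 ch2) hC2)].
under eq_Rintegral do rewrite -mulrBr.
apply: (@norm_convolution_le _ _ (fun s =>
  (h1 \_ `[0, T]) s - (h2 \_ `[0, T]) s) iK0 _ (C1 + C2)) => //.
- by apply: measurable_funB; exact: mh0.
- by move=> s; apply: (le_trans (ler_normB _ _)); exact: lerD.
- move=> s _; rewrite !patchE; case: ifPn => [|_].
    by rewrite inE/= in_itv/= => /hD.
  by rewrite subrr normr0 mulr_ge0 ?expR_ge0.
Qed.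

End volterra.

(** * Second order Volterra systems *)

Lemma geometric_small (R : realType) (C e : R) : 0 < e -> exists n, C / 2 ^+ n <= e.
Proof.
move=> e0; exists (Num.bound (C / e)).
rewrite ler_pdivrMr ?exprn_gt0// mulrC -ler_pdivrMr//.
exact/ltW/upper_nthrootP.
Qed.

(** Banach's fixed point theorem with pointwise inequalities in place of a metric: [D] stands for a
    bound on the weighted distance. The upper bound [W] on the weight turns weighted smallness into
    uniform smallness on [A], under whose limits [P] is closed. *)
Lemma weighted_contraction_fixpoint (R : realType) (X : Type) (A : set X)
    (w : X -> R) (W : R) (P : set (X -> R)) (Phi : (X -> R) -> X -> R) (u0 : X -> R) :
  (forall x, A x -> 0 <= w x <= W) ->
  P u0 -> (forall u, P u -> P (Phi u)) ->
  (forall u_ u, (forall n : nat, P (u_ n)) ->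
    (forall e : R, 0 < e -> exists n, forall x, A x -> `|u_ n x - u x| <= e) -> P u) ->
  (forall u v D, P u -> P v -> 0 <= D ->
    (forall x, A x -> `|u x - v x| <= D * w x) ->
    forall x, A x -> `|Phi u x - Phi v x| <= D / 2 * w x) ->
  (exists2 D, 0 <= D & forall x, A x -> `|Phi u0 x - u0 x| <= D * w x) ->
  exists2 u, P u & forall x, A x -> Phi u x = u x.
Proof.
move=> wW Pu0 PPhi Pcl ctr [D D0 HD].
pose u_ n := iter n Phi u0.
have Pu n : P (u_ n) by elim: n => // n IH; exact: PPhi.
have step n x : A x -> `|u_ n.+1 x - u_ n x| <= D / 2 ^+ n * w x.
  elim: n x => [|n IH] x Ax; first by rewrite expr0 divr1; exact: HD.
  have := ctr _ _ _ (Pu n.+1) (Pu n) _ IH x Ax.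
  by rewrite exprSr invfM mulrA; apply; rewrite divr_ge0// exprn_ge0.
(* The right-hand side is the exact value of the geometric sum of the steps from n to n + i, so that
   the induction on [i] closes with an equality. *)
have dist n i x : A x -> `|u_ (i + n)%N x - u_ n x| <= (2 * (D / 2 ^+ n) - 2 * (D / 2 ^+
  (i + n))) * w x.
  move=> Ax; elim: i => [|i IH]; first by rewrite !subrr normr0 mul0r.
  have := step (i + n)%N _ Ax; have := ler_normD (u_ (i + n).+1 x - u_ (i + n)%N x) (u_
    (i + n)%N x - u_ n x).
  rewrite addrA subrK addSn => h1 h2; apply: (le_trans h1); apply: (le_trans (lerD h2 IH)).
  rewrite -mulrDl exprSr invfM mulrA le_eqVlt; apply/orP; left; apply/eqP.
  by congr (_ * _); lra.
have dist' n i x : A x -> (n <= i)%N -> `|u_ i x - u_ n x| <= 2 * D / 2 ^+ n * w x.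
  move=> Ax ni; have := dist n (i - n)%N x Ax; rewrite subnK// => /le_trans; apply.
  apply: ler_wpM2r; first by have /andP[] := wW _ Ax.
  have : 0 <= D / 2 ^+ i by rewrite divr_ge0// exprn_ge0.
  by rewrite -mulrA; lra.
have small e : 0 < e -> exists n, forall x, A x -> 2 * D / 2 ^+ n * w x <= e.
  move=> e0; have [n Hn] := geometric_small (2 * D * W) e0.
  exists n => x Ax; apply: le_trans Hn; rewrite mulrAC; apply: ler_wpM2r.
    by rewrite invr_ge0 exprn_ge0.
  by apply: ler_wpM2l; [rewrite mulr_ge0|have /andP[] := wW _ Ax].
pose u x := lim (u_ n x @[n --> \oo]).
have cu x : A x -> u_ n x @[n --> \oo] --> u x.
  move=> Ax; apply: cauchy_cvg; apply: cauchy_exP => e e0.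
  have [n Hn] := small (e / 2) (divr_gt0 e0 (ltr0Sn _ _)).
  exists (u_ n x); exists n => // i /= ni.
  rewrite /ball/= distrC; apply: (le_lt_trans (dist' n i x Ax ni)).
  by apply: (le_lt_trans (Hn x Ax)); lra.
have lim_dist n x : A x -> `|u_ n x - u x| <= 2 * D / 2 ^+ n * w x.
  move=> Ax; apply/ler_addgt0Pr => e e0.
  have /cvgrPdist_lt/(_ e e0)[N _ HN] := cu x Ax.
  pose i := maxn n N.
  have h1 : `|u_ i x - u x| < e by rewrite distrC; exact: (HN i (leq_maxr _ _)).
  have h2 : `|u_ n x - u_ i x| <= 2 * D / 2 ^+ n * w x.
    by rewrite distrC; exact: dist' (leq_maxl _ _).
  have := ler_normD (u_ n x - u_ i x) (u_ i x - u x).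
  by rewrite addrA subrK; lra.
have Pu' : P u.
  apply: (Pcl u_) => // e e0; have [n Hn] := small e e0.
  by exists n => x Ax; apply: le_trans (Hn x Ax); exact: lim_dist.
exists u => // x Ax; apply/eqP; rewrite -subr_eq0 -normr_le0; apply/ler_addgt0Pr => e e0.
rewrite add0r; have [n Hn] := small (e / 2) (divr_gt0 e0 (ltr0Sn _ _)).
have Dn0 k : 0 <= 2 * D / 2 ^+ k by rewrite divr_ge0 ?mulr_ge0// exprn_ge0.
have h1 := ctr _ _ _ (Pu n) Pu' (Dn0 n) (lim_dist n) x Ax.
have h2 := lim_dist n.+1 x Ax; have h3 := Hn x Ax.
have h4 := ler_normD (Phi u x - u_ n.+1 x) (u_ n.+1 x - u x).
have h5 : 2 * D / 2 ^+ n.+1 * w x = 2 * D / 2 ^+ n / 2 * w x.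
  by rewrite exprSr invfM mulrA.
move: h1 h4; rewrite addrA subrK distrC -/(u_ n.+1) => h1 h4.
have h6 : 2 * D / 2 ^+ n / 2 * w x = (2 * D / 2 ^+ n * w x) / 2 by rewrite mulrAC.
move: h2; rewrite h5 h6; move: h1; rewrite h6; lra.
Qed.

Lemma within_continuous_uniform_limit (R : realType) (A : set R) (u : R -> R) :
  (forall e : R, 0 < e -> exists2 v : R -> R, {within A, continuous v} &
    forall x, A x -> `|v x - u x| <= e) ->
  {within A, continuous u}.
Proof.
move=> Hu; apply/subspace_continuousP => x Ax; apply/cvgrPdist_lt => e e0.
have [|v cv vu] := Hu (e / 4); first by rewrite divr_gt0.
move/subspace_continuousP : cv => /(_ x Ax)/cvgrPdist_lt/(_ (e / 4)).
rewrite divr_gt0// => /(_ isT) Hv.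
have HA : \forall y \near within A (nbhs x), A y by exact: withinT.
apply: filterS2 Hv HA => y vxy Ay.
have h1 : `|u x - v x| <= e / 4 by rewrite distrC; exact: vu.
have h2 := vu y Ay.
have h3 := ler_normD (u x - v x) (v x - u y); have h4 := ler_normD (v x - v y) (v y - u y).
move: h3 h4; rewrite !addrA !subrK; lra.
Qed.

Lemma within_continuous_bounded (R : realType) (a b : R) (f : R -> R) : a <= b ->
  {within `[a, b], continuous f} -> exists2 C, 0 <= C & forall x, a <= x <= b -> `|f x|
    <= C.
Proof.
move=> ab cf.
have cn : {within `[a, b], continuous (fun x => `|f x|)}.
  by move=> x; apply: continuous_comp; [exact: cf|exact: norm_continuous].
have [c _ Hc] := EVT_max ab cn.
by exists `|f c| => // x xab; apply: Hc; rewrite in_itv.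
Qed.

(** * Contraction, uniqueness and existence for the system in coefficients *)

Section volterra_system.
Context (R : realType).
Local Notation mu := (@lebesgue_measure R).
Variables (m : nat) (T : R) (K : R -> R) (M S : 'M[R]_m).
Variables (q : 'I_m -> R -> R) (c0 c1 : 'I_m -> R).
Hypotheses (T0 : 0 < T) (iK : mu.-integrable `]0, T[ (EFin \o K)).
Hypothesis uM : M \in unitmx.
Hypothesis iq : forall k, mu.-integrable `]0, T[ (EFin \o q k).

Definition memory_load (y : 'I_m -> R -> R) (k : 'I_m) (t : R) : R :=
  \sum_j y j t * S j k - volterra K (fun s => \sum_j y j s * S j k) t.

(** The right-hand side of the system once it is solved for the second derivatives; coefficient
    vectors act as rows, so the inverse mass matrix multiplies on the right. *)
Definition solved_load (y : 'I_m -> R -> R) (j : 'I_m) (t : R) : R :=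
  \sum_k (q k t - memory_load y k t) * invmx M k j.

Definition volterra_solution (y y1 y2 : 'I_m -> R -> R) : Prop :=
  [/\ forall j, twice_weakly_derivable T (y j) (y1 j) (y2 j),
      forall j, y j 0 = c0 j, forall j, y1 j 0 = c1 j &
      {ae mu, forall t, 0 < t < T -> forall k,
        \sum_j y2 j t * M j k + memory_load y k t = q k t}].

Lemma solve_massE (y2 r : 'I_m -> R) :
  (forall k, \sum_j y2 j * M j k = r k) <->
  (forall j, y2 j = \sum_k r k * invmx M k j).
Proof.
have E (v w : 'I_m -> R) (B : 'M[R]_m) :
    (forall k, \sum_j v j * B j k = w k) <-> (\row_j v j) *m B = \row_k w k.
  split=> [vw|/rowP vw k].
    by apply/rowP => k; rewrite !mxE -vw; apply: eq_bigr => j _; rewrite mxE.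
  by have := vw k; rewrite !mxE => <-; apply: eq_bigr => j _; rewrite mxE.
split=> [/E yr j|yr].
  suff : (\row_k r k) *m invmx M = \row_j y2 j by move/E => ->.
  by rewrite -yr mulmxK.
apply/E; suff <- : (\row_k r k) *m invmx M = \row_j y2 j by rewrite mulmxKV.
by apply/E => j; rewrite yr.
Qed.

Let cstiff (y : 'I_m -> R -> R) : (forall j, {within `[0, T], continuous (y j)}) ->
  forall k, {within `[0, T], continuous (fun s => \sum_j y j s * S j k)}.
Proof.
move=> cy k; elim: (index_enum _) => [|i r IH].
  have -> : (fun s => \sum_(j <- [::]) y j s * S j k) = (fun=> 0).
    by apply/funext => s; rewrite big_nil.
  by move=> x; exact: cst_continuous.
have -> : (fun s => \sum_(j <- i :: r) y j s * S j k) =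
    (fun s => y i s * S i k + \sum_(j <- r) y j s * S j k).
  by apply/funext => s; rewrite big_cons.
move=> x.
apply: (@continuousD R R^o (subspace `[0, T]) (fun s => y i s * S i k)) => //;
  last exact: IH.
apply: (@continuousM R (subspace `[0, T]) (y i) (fun=> S i k)); first exact: cy.
exact: cst_continuous.
Qed.

(** Summing over [j] too gives one bound for all components. [C] is a Lipschitz constant of
    [solved_load] in the weighted norm. Since (1 + 2C)^2 = 1 + 4C + 4C^2 >= 2C, the choice of [lam]
    yields the contraction factor 1/2; the summand 1 keeps [lam] positive when C = 0. *)
Let b := \sum_j \sum_k \sum_i `|S i k| * `|invmx M k j|.
Let kappa := \int[mu]_(s in `]0, T[) `|K s|.
Let C := b * (1 + kappa).
Let lam := 1 + 2 * C.

Let b0 : 0 <= b.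
Proof. by do 3!apply: sumr_ge0 => ? _; rewrite mulr_ge0. Qed.

Let kappa0 : 0 <= kappa. Proof. exact: Rintegral_ge0. Qed.

Let C0 : 0 <= C. Proof. by rewrite mulr_ge0// addr_ge0. Qed.

Let lam0 : 0 < lam. Proof. by rewrite /lam ltr_pwDl// mulr_ge0. Qed.

Let lam2 : C / lam ^+ 2 <= 1 / 2.
Proof.
rewrite ler_pdivrMr ?exprn_gt0// /lam.
have : 0 <= C ^+ 2 by rewrite exprn_ge0.
have -> : (1 + 2 * C) ^+ 2 = 1 + 4 * C + 4 * C ^+ 2 by ring.
by have := C0; lra.
Qed.

(** The load [q] cancels in the difference. Of the factor [1 + kappa] in [C], the 1 comes from the
    instantaneous stiffness term and [kappa] from the memory term. *)
Lemma solved_load_dist_le (y z : 'I_m -> R -> R) (D : R) : 0 <= D ->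
  (forall j, {within `[0, T], continuous (y j)}) ->
  (forall j, {within `[0, T], continuous (z j)}) ->
  (forall j t, 0 <= t <= T -> `|y j t - z j t| <= D * expR (lam * t)) ->
  forall j t, 0 < t < T ->
    `|solved_load y j t - solved_load z j t| <= C * D * expR (lam * t).
Proof.
move=> D0 cy cz yz j t tT; have tT' : 0 <= t <= T by lra.
have stiff k s : 0 <= s <= T ->
    `|\sum_i y i s * S i k - \sum_i z i s * S i k| <= (\sum_i `|S i k|) * D * expR (lam *
      s).
  move=> sT; rewrite -sumrB -mulrA mulr_suml; apply: (le_trans (ler_norm_sum _ _ _)).
  apply: ler_sum => i _; rewrite -mulrBl normrM mulrC.
  by apply: ler_wpM2l => //; exact: yz.
have load k : `|memory_load y k t - memory_load z k t| <=
    (\sum_i `|S i k|) * D * expR (lam * t) * (1 + kappa).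
  have Sk0 : 0 <= (\sum_i `|S i k|) * D by rewrite mulr_ge0// sumr_ge0.
  have h1 := stiff k t tT'.
  have h2 := volterra_dist_le T0 iK (@cstiff y cy k) (@cstiff z cz k) (ltW lam0) Sk0
    (stiff k) tT.
  rewrite /memory_load; rewrite mulrDr mulr1.
  set a1 := \sum_j y j t * _ in h1 *; set a2 := \sum_j z j t * _ in h1 *.
  set v1 := volterra _ _ _ in h2 *; set v2 := volterra _ _ _ in h2 *.
  have -> : a1 - v1 - (a2 - v2) = (a1 - a2) - (v1 - v2) by ring.
  by apply: (le_trans (ler_normB _ _)); exact: lerD.
rewrite /solved_load -sumrB.
apply: (@le_trans _ _ (\sum_k \sum_i `|S i k| * `|invmx M k j| * (D * expR (lam * t) * (1
  + kappa)))).
  apply: (le_trans (ler_norm_sum _ _ _)); apply: ler_sum => k _.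
  rewrite -mulrBl normrM -mulr_suml -mulr_suml.
  have -> : q k t - memory_load y k t - (q k t - memory_load z k t) =
    memory_load z k t - memory_load y k t by ring.
  rewrite distrC.
  have -> : (\sum_i `|S i k|) * `|invmx M k j| * (D * expR (lam * t) * (1 + kappa)) =
     (\sum_i `|S i k|) * D * expR (lam * t) * (1 + kappa) * `|invmx M k j| by ring.
  exact: ler_wpM2r.
under eq_bigr do rewrite -mulr_suml.
rewrite -mulr_suml /C.
have -> : b * (1 + kappa) * D * expR (lam * t) = b * (D * expR (lam * t) * (1 + kappa))
  by ring.
apply: ler_wpM2r; first by rewrite !mulr_ge0 ?expR_ge0// addr_ge0.
rewrite /b [leRHS](bigD1 j)//= lerDl; apply: sumr_ge0 => ? _.
by do 2!apply: sumr_ge0 => ? _; rewrite mulr_ge0.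
Qed.

Lemma volterra_system_contraction (u v y y1 y2 z z1 z2 : 'I_m -> R -> R) (D : R) :
  0 <= D ->
  (forall j, {within `[0, T], continuous (u j)}) ->
  (forall j, {within `[0, T], continuous (v j)}) ->
  (forall j, twice_weakly_derivable T (y j) (y1 j) (y2 j)) ->
  (forall j, twice_weakly_derivable T (z j) (z1 j) (z2 j)) ->
  (forall j, y j 0 = z j 0) -> (forall j, y1 j 0 = z1 j 0) ->
  {ae mu, forall t, 0 < t < T -> forall j, y2 j t = solved_load u j t} ->
  {ae mu, forall t, 0 < t < T -> forall j, z2 j t = solved_load v j t} ->
  (forall j t, 0 <= t <= T -> `|u j t - v j t| <= D * expR (lam * t)) ->
  forall j t, 0 <= t <= T -> `|y j t - z j t| <= D / 2 * expR (lam * t).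
Proof.
move=> D0 cu cv dy dz yz0 yz1 ey ez uv j t tT.
have := @twice_weakly_derivable_growth R T (C * D) lam _ _ _ lam0 (mulr_ge0 C0 D0)
  (twice_weakly_derivableB (dy j) (dz j)).
rewrite yz0 yz1 !subrr => /(_ erefl erefl) H.
apply: (le_trans (H _ t tT)).
  have aeF := ae_filter_ringOfSetsType mu.
  apply: filterS2 ey ez => s Hy Hz sT; rewrite Hy// Hz//.
  exact: solved_load_dist_le.
apply: ler_wpM2r; first exact: expR_ge0.
rewrite mulrAC; have := ler_wpM2r D0 lam2; lra.
Qed.

Lemma volterra_system_unique (y y1 y2 z z1 z2 : 'I_m -> R -> R) :
  volterra_solution y y1 y2 -> volterra_solution z z1 z2 ->
  forall j t, 0 <= t <= T -> y j t = z j t.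
Proof.
have load x x1 x2 : volterra_solution x x1 x2 ->
    {ae mu, forall t, 0 < t < T -> forall j, x2 j t = solved_load x j t}.
  move=> [_ _ _]; have aeF := ae_filter_ringOfSetsType mu; apply: filterS => t Hx tT j.
  apply: (solve_massE (x2 ^~ t) (fun k => q k t - memory_load x k t)).1 => k.
  by rewrite -(Hx tT k) addrK.
move=> soly solz; have ly := load _ _ _ soly; have lz := load _ _ _ solz.
case: soly solz => [dy y0 y10 _] [dz z0 z10 _].
have cy j : {within `[0, T], continuous (y j)} by case: (dy j).
have cz j : {within `[0, T], continuous (z j)} by case: (dz j).
have cyz j : {within `[0, T], continuous (fun t => y j t - z j t)}.
  by case: (twice_weakly_derivableB (dy j) (dz j)).
have [D D0 HD] : exists2 D, 0 <= D & forall j t, 0 <= t <= T -> `|y j t - z j t| <= D.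
  have /choice[B HB] : forall j, exists B, 0 <= B /\ forall t, 0 <= t <= T -> `|y j t - z
    j t| <= B.
    by move=> j; have [B ? ?] := within_continuous_bounded (ltW T0) (cyz j); exists B.
  exists (\sum_j B j) => [|j t tT]; first by apply: sumr_ge0 => j _; have [] := HB j.
  have [_ /(_ t tT)/le_trans] := HB j; apply.
  by rewrite (bigD1 j)//= lerDl; apply: sumr_ge0 => i _; have [] := HB i.
(* For two solutions of the full system the contraction returns the same pair with its weighted
   distance halved, so it can be repeated. It starts because the weight is at least 1 on [0, T]. *)
have bound n : forall j t, 0 <= t <= T -> `|y j t - z j t| <= D / 2 ^+ n * expR (lam * t).
  elim: n => [|n IH] j t tT.
    rewrite expr0 divr1; apply: (le_trans (HD j t tT)).
    rewrite ler_peMr// -expR0 ler_expR mulr_ge0 ?(ltW lam0)//; by case/andP: tT.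
  rewrite exprSr invfM mulrA.
  apply: (@volterra_system_contraction y z y y1 y2 z z1 z2) => //.
  - by rewrite divr_ge0// exprn_ge0.
  - by move=> i; rewrite y0 z0.
  - by move=> i; rewrite y10 z10.
move=> j t tT; apply/eqP; rewrite -subr_eq0 -normr_le0; apply/ler_addgt0Pr => e e0.
rewrite add0r; have [n Hn] := geometric_small (D * expR (lam * t)) e0.
by apply: (le_trans (bound n j t tT)); rewrite mulrAC.
Qed.

Lemma solved_load_integrable (y : 'I_m -> R -> R) :
  (forall j, {within `[0, T], continuous (y j)}) ->
  forall j, mu.-integrable `]0, T[ (EFin \o solved_load y j).
Proof.
move=> cy j; have : mu.-integrable `]0, T[
    (fun t => \sum_k ((q k t - memory_load y k t) * invmx M k j)%:E)%E.
  apply: integrable_sum => //= k _.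
  have iS : mu.-integrable `]0, T[ (EFin \o (fun s => \sum_i y i s * S i k)).
    apply: (@integrableS _ _ _ mu `[0, T]%classic) => //.
    - by move=> s /=; rewrite !in_itv/= => /andP[? ?]; apply/andP; split; exact: ltW.
    - by apply: continuous_compact_integrable; [exact: segment_compact|exact: cstiff].
  have iV := volterra_integrable T0 iK (@cstiff y cy k).
  have mI : measurable (`]0, T[%classic : set (measurableTypeR R)) by exact: measurable_itv.
  have := integrableZr mI (invmx M k j) (integrableB mI (iq k) (integrableB mI iS iV)).
  by apply: eq_integrable.
by apply: eq_integrable => // t _; rewrite /= sumEFin.
Qed.

Lemma volterra_system_exists : exists y y1 y2, volterra_solution y y1 y2.
Proof.
pose P (u : 'I_m * R -> R) := forall j, {within `[0, T], continuous (fun t => u (j, t))}.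
(* [get] picks a function with second derivative [h] and the prescribed initial data, so that [Phi]
   is total; outside [P] its value may be an arbitrary default. Indexing by pairs (j, t) turns the
   system into one scalar function for the fixed point lemma. *)
pose ivp j (h : R -> R) := get [set y | exists y1,
  [/\ twice_weakly_derivable T y y1 h, y 0 = c0 j & y1 0 = c1 j]].
pose Phi (u : 'I_m * R -> R) (p : 'I_m * R) :=
  ivp p.1 (solved_load (fun j t => u (j, t)) p.1) p.2.
have ivpP u j : P u -> exists y1,
    [/\ twice_weakly_derivable T (fun t => Phi u (j, t)) y1 (solved_load (fun j t =>
      u (j, t)) j),
        Phi u (j, 0) = c0 j & y1 0 = c1 j].
  move=> Pu; have [y [y1 yP]] := ex_twice_weakly_derivable (c0 j) (c1 j) T0
    (solved_load_integrable Pu j).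
  have [|y1' H] := @getPex _ [set y | exists y1, [/\ twice_weakly_derivable T y y1
      (solved_load (fun j t => u (j, t)) j), y 0 = c0 j & y1 0 = c1 j]].
    by exists y, y1.
  by exists y1'.
pose A (p : 'I_m * R) := 0 <= p.2 <= T.
pose w (p : 'I_m * R) := expR (lam * p.2).
have PPhi u : P u -> P (Phi u) by move=> Pu j; have [y1 [[]]] := ivpP u j Pu.
have P0 : P (fun=> 0) by move=> j x; exact: cst_continuous.
have [||||u Pu Hu] := @weighted_contraction_fixpoint R _ A w (expR (lam * T)) P Phi
  (fun=> 0) _ P0 PPhi.
- move=> [j t] /andP[/= t0 tT]; rewrite expR_ge0/= ler_expR ler_wpM2l//; exact: ltW.
- move=> u_ u Pu_ Hu j; apply: within_continuous_uniform_limit => e /Hu[n Hn].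
  exists (fun t => u_ n (j, t)); first exact: Pu_.
  by move=> t; rewrite /= in_itv/= => tT; exact: (Hn (j, t)).
- move=> u v D Pu Pv D0 uv [j t] tT.
  have /choice[y1 Hy] := fun j => ivpP u j Pu; have /choice[z1 Hz] := fun j => ivpP v j Pv.
  apply: (@volterra_system_contraction (fun j t => u (j, t)) (fun j t => v (j, t))
    (fun j t => Phi u (j, t)) y1 (solved_load (fun j t => u (j, t)))
    (fun j t => Phi v (j, t)) z1 (solved_load (fun j t => v (j, t))) D).
  + exact: D0.
  + exact: Pu.
  + exact: Pv.
  + by move=> i; have [] := Hy i.
  + by move=> i; have [] := Hz i.
  + by move=> i; have [_ -> _] := Hy i; have [_ -> _] := Hz i.
  + by move=> i; have [_ _ ->] := Hy i; have [_ _ ->] := Hz i.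
  + exact: aeW.
  + exact: aeW.
  + by move=> i s sT; exact: (uv (i, s)).
  + exact: tT.
- have /choice[B HB] : forall j, exists B, 0 <= B /\ forall t, 0 <= t <= T -> `|Phi
  (fun=> 0) (j, t)| <= B.
    by move=> j; have [B ? ?] := within_continuous_bounded (ltW T0) (PPhi _ P0 j); exists B.
  exists (\sum_j B j) => [|[j t] tT]; first by apply: sumr_ge0 => j _; have [] := HB j.
  rewrite subr0; have [_ /(_ t tT)/le_trans] := HB j; apply.
  apply: (@le_trans _ _ (\sum_j B j)).
    by rewrite (bigD1 j)//= lerDl; apply: sumr_ge0 => i _; have [] := HB i.
  rewrite ler_peMr//; first by apply: sumr_ge0 => i _; have [] := HB i.
  by rewrite /w -expR0 ler_expR mulr_ge0 ?(ltW lam0)//; case/andP: tT.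
have /choice[y1 Hy] := fun j => ivpP u j Pu.
(* [Phi u] is returned rather than [u] because it comes with its derivatives. The two agree on
   [0, T], which is all that the memory load at a time in []0, T[] depends on. *)
exists (fun j t => Phi u (j, t)), y1, (solved_load (fun j t => u (j, t))); split.
- by move=> j; have [] := Hy j.
- by move=> j; have [] := Hy j.
- by move=> j; have [] := Hy j.
apply: aeW => t tT k.
have -> : memory_load (fun j t => Phi u (j, t)) k t = memory_load (fun j t => u (j, t)) k t.
  rewrite /memory_load; congr (_ - _).
    by apply: eq_bigr => j _; rewrite Hu// /A/=; lra.
  rewrite /volterra; apply: eq_Rintegral => s; rewrite inE/= in_itv/= => st.
  congr (_ * _); apply: eq_bigr => j _; rewrite Hu// /A/=; lra.
have -> : \sum_j solved_load (fun j t => u (j, t)) j t * M j k =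
    q k t - memory_load (fun j t => u (j, t)) k t.
  exact: (solve_massE (solved_load (fun j t => u (j, t)) ^~ t)
    (fun k => q k t - memory_load (fun j t => u (j, t)) k t)).2.
by rewrite subrK.
Qed.

End volterra_system.

(** * L2 and Bochner spaces *)

Section mxdot_theory.
Context (R : realType) (p q : nat).
Implicit Types A B : 'M[R]_(p, q).

Lemma mxdotC A B : mxdot A B = mxdot B A.
Proof. by apply: eq_bigr => i _; apply: eq_bigr => j _; rewrite mulrC. Qed.

Lemma mxdot_sumZl n (c : 'I_n -> R) (A : 'I_n -> 'M[R]_(p, q)) B :
  mxdot (\sum_i c i *: A i) B = \sum_i c i * mxdot (A i) B.
Proof.
rewrite /mxdot; under [RHS]eq_bigr do rewrite mulr_sumr.
rewrite [RHS]exchange_big/=; apply: eq_bigr => i _.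
under [RHS]eq_bigr do rewrite mulr_sumr.
rewrite [RHS]exchange_big/=; apply: eq_bigr => j _.
rewrite summxE mulr_suml; apply: eq_bigr => k _.
by rewrite mxE mulrA.
Qed.

Lemma mxdot_ge0 A : 0 <= mxdot A A.
Proof. by apply: sumr_ge0 => i _; apply: sumr_ge0 => j _; rewrite -expr2 sqr_ge0. Qed.

Lemma mxdot_eq0 A : mxdot A A = 0 -> A = 0.
Proof.
move=> /eqP; rewrite psumr_eq0; last first.
  by move=> i _; apply: sumr_ge0 => j _; rewrite -expr2 sqr_ge0.
move=> /allP HA; apply/matrixP => i j; rewrite mxE.
have := HA i (mem_index_enum _); rewrite /= psumr_eq0; last first.
  by move=> k _; rewrite -expr2 sqr_ge0.
move=> /allP/(_ j (mem_index_enum _)) /=.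
by rewrite -expr2 sqrf_eq0 => /eqP.
Qed.

(** Young's inequality, entry by entry from the square of e|x| - |y|; the free weight [e] is tuned
    to the norm of the argument in [ip_le_L2norm]. *)
Lemma norm_mxdot_le A B (e : R) : 0 < e ->
  2 * `|mxdot A B| <= e * mxdot A A + mxdot B B / e.
Proof.
move=> e0; apply: (@le_trans _ _ (\sum_i \sum_j 2 * `|A i j * B i j|)).
  rewrite /mxdot; under [leRHS]eq_bigr do rewrite -mulr_sumr.
  rewrite -mulr_sumr ler_wpM2l//; apply: (le_trans (ler_norm_sum _ _ _)).
  by apply: ler_sum => i _; exact: ler_norm_sum.
rewrite /mxdot mulr_sumr mulr_suml -big_split/=; apply: ler_sum => i _.
rewrite mulr_sumr mulr_suml -big_split/=; apply: ler_sum => j _.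
rewrite normrM; set x := A i j; set y := B i j.
have e1 : e * e^-1 = 1 by rewrite divff// gt_eqF.
have : 0 <= (e * `|x| - `|y|) ^+ 2 / e by rewrite divr_ge0 ?sqr_ge0// ltW.
have -> : (e * `|x| - `|y|) ^+ 2 / e =
   (e * e^-1) * (e * `|x| ^+ 2 - 2 * (`|x| * `|y|)) + `|y| ^+ 2 / e by ring.
by rewrite e1 !real_normK ?num_real// !expr2; lra.
Qed.

End mxdot_theory.

Section L2_theory.
Context (R : realType) (disp : measure_display) (X : measurableType disp).
Variables (mu : {measure set X -> \bar R}) (D : set X) (p q : nat).
Implicit Types u v : X -> 'M[R]_(p, q).

Lemma measurable_mxdot u v :
  (forall i j, measurable_fun D (fun x => u x i j)) ->
  (forall i j, measurable_fun D (fun x => v x i j)) ->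
  measurable_fun D (fun x => mxdot (u x) (v x)).
Proof.
move=> mu' mv; apply: measurable_sum => i; apply: measurable_sum => j.
exact: measurable_funM.
Qed.

Lemma L2_integrable_sqr u : L2 mu D u -> mu.-integrable D (fun x => (mxdot (u x) (u x))%:E).
Proof.
move=> [mD mu' fu]; apply/integrableP; split.
  by apply/measurable_EFinP; exact: measurable_mxdot.
apply: le_lt_trans fu; rewrite le_eqVlt; apply/orP; left; apply/eqP.
by apply: eq_integral => x _; rewrite /= ger0_norm// mxdot_ge0.
Qed.

Lemma L2_integrable u v : L2 mu D u -> L2 mu D v ->
  mu.-integrable D (fun x => (mxdot (u x) (v x))%:E).
Proof.
move=> Lu Lv; have [mD mu' _] := Lu; have [_ mv _] := Lv.
have := integrableD mD (L2_integrable_sqr Lu) (L2_integrable_sqr Lv).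
apply: le_integrable => //; first by apply/measurable_EFinP; exact: measurable_mxdot.
move=> x _; rewrite /= lee_fin.
have := @norm_mxdot_le R p q (u x) (v x) 1 ltr01; rewrite mul1r divr1.
have u0 := mxdot_ge0 (u x); have v0 := mxdot_ge0 (v x).
move=> h; rewrite [leRHS]ger0_norm ?addr_ge0//.
by have := normr_ge0 (mxdot (u x) (v x)); lra.
Qed.

Lemma ip_sumZl n (c : 'I_n -> R) (u : 'I_n -> X -> 'M[R]_(p, q)) v :
  (forall i, L2 mu D (u i)) -> L2 mu D v ->
  ip mu D (fun x => \sum_i c i *: u i x) v = \sum_i c i * ip mu D (u i) v.
Proof.
move=> Lu Lv; have [mD _ _] := Lv; rewrite /ip.
under eq_Rintegral do rewrite mxdot_sumZl.
rewrite /Rintegral; under eq_integral do rewrite -sumEFin.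
have ii i : mu.-integrable D (fun x => (c i * mxdot (u i x) (v x))%:E).
  by have := integrableZl mD (c i) (L2_integrable (Lu i) Lv); apply: eq_integrable.
rewrite integral_sum// -sum_fine; last by move=> i _; exact: integrable_fin_num.
by apply: eq_bigr => i _; rewrite -[LHS]/(Rintegral _ _ _) RintegralZl//;
  exact: L2_integrable.
Qed.

Lemma L2_sumZ n (c : 'I_n -> R) (u : 'I_n -> X -> 'M[R]_(p, q)) : measurable D ->
  (forall i, L2 mu D (u i)) -> L2 mu D (fun x => \sum_i c i *: u i x).
Proof.
move=> mD Lu.
have mS i j : measurable_fun D (fun x => (\sum_k c k *: u k x) i j).
  under eq_fun do rewrite summxE.
  apply: measurable_sum => k; under eq_fun do rewrite mxE.
  by apply: measurable_funM => //; case: (Lu k).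
split => //.
have ii : mu.-integrable D (fun x =>
  (mxdot (\sum_i c i *: u i x) (\sum_i c i *: u i x))%:E).
  have : mu.-integrable D (fun x =>
    (\sum_i \sum_k (c i * c k * mxdot (u i x) (u k x))%:E)%E).
    apply: integrable_sum => //= i _; apply: integrable_sum => //= k _.
    by have := integrableZl mD (c i * c k) (L2_integrable (Lu i) (Lu k));
      apply: eq_integrable.
  apply: eq_integrable => // x _; rewrite mxdot_sumZl -sumEFin.
  apply: eq_bigr => i _; rewrite mxdotC mxdot_sumZl mulr_sumr -sumEFin.
  by apply: eq_bigr => k _; rewrite mulrA mxdotC.
case/integrableP: ii => _; apply: le_lt_trans; rewrite le_eqVlt; apply/orP; left.
by apply/eqP; apply: eq_integral => x _; rewrite /= ger0_norm// mxdot_ge0.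
Qed.

Lemma L2B u v : L2 mu D u -> L2 mu D v -> L2 mu D (fun x => u x - v x).
Proof.
move=> Lu Lv; have [mD _ _] := Lu.
have := @L2_sumZ 2 (fun i => if i == 0 then 1 else -1) (fun i =>
  if i == 0 then u else v) mD.
have -> : (fun x => \sum_(i < 2) (if i == 0 then 1 else -1) *: (if i == 0 then u else v)
  x) =
   (fun x => u x - v x).
  by apply/funext => x; rewrite big_ord_recl big_ord1/= scale1r scaleN1r.
by apply => i; case: ifP.
Qed.

Lemma ipB u v w : L2 mu D u -> L2 mu D v -> L2 mu D w ->
  ip mu D (fun x => u x - v x) w = ip mu D u w - ip mu D v w.
Proof.
move=> Lu Lv Lw; have [mD _ _] := Lu; rewrite /ip.
rewrite -RintegralB//; [|exact: L2_integrable..].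
apply: eq_Rintegral => x _; rewrite -[u x - v x]addrC -scaleN1r.
have := @mxdot_sumZl R p q 2 (fun i => if i == 0 then 1 else -1) (fun i =>
  if i == 0 then u x else v x) (w x).
by rewrite !big_ord_recl !big_ord0/= scale1r scaleN1r mul1r mulN1r !addr0 addrC.
Qed.

Lemma L2norm_sqr u : L2 mu D u -> L2norm mu D u ^+ 2 = ip mu D u u.
Proof.
by move=> Lu; rewrite sqr_sqrtr// fine_ge0// integral_ge0// => x _;
  rewrite lee_fin mxdot_ge0.
Qed.

Lemma ip_eq0 u : L2 mu D u -> ip mu D u u = 0 -> u = (fun=> 0) %[ae mu in D].
Proof.
move=> Lu uu0; have [mD mu' _] := Lu.
have : (\int[mu]_(x in D) `|(mxdot (u x) (u x))%:E| = 0)%E.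
  under eq_integral do rewrite abse_EFin ger0_norm ?mxdot_ge0//.
  have := integrable_fin_num mD (L2_integrable_sqr Lu) => /fineK <-.
  by rewrite [X in X%:E]uu0.
move=> /(ae_eq_integral_abs mu mD) H.
have {}H : ae_eq mu D (fun x => (mxdot (u x) (u x))%:E) (cst 0%E).
  by apply: H; apply/measurable_EFinP; exact: measurable_mxdot.
have aeF := ae_filter_ringOfSetsType mu.
by apply: filterS H => x Hx /Hx[] /mxdot_eq0.
Qed.

(** A crude Cauchy-Schwarz inequality: Young's inequality with [e] the inverse of the norm of [u] is
    already linear in that norm. The 1 in the constant makes it positive, so that it can be divided
    by. *)
Lemma ip_le_L2norm v : L2 mu D v ->
  exists2 C, 0 < C & forall u, L2 mu D u -> `|ip mu D u v| <= C * L2norm mu D u.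
Proof.
move=> Lv; have [mD _ _] := Lv.
have B0 : 0 <= ip mu D v v by apply: Rintegral_ge0 => x _; exact: mxdot_ge0.
exists (1 + ip mu D v v) => [|u Lu]; first by rewrite ltr_pwDl.
have young e : 0 < e -> 2 * `|ip mu D u v| <= e * ip mu D u u + ip mu D v v / e.
  move=> e0; have iuv := L2_integrable Lu Lv.
  have iu := L2_integrable Lu Lu; have iv := L2_integrable Lv Lv.
  have iuvn : mu.-integrable D (EFin \o (fun x => `|mxdot (u x) (v x)|)).
    by have := integrable_abse iuv; apply: eq_integrable.
  have ieu : mu.-integrable D (EFin \o (fun x => e * mxdot (u x) (u x))).
    by have := integrableZl mD e iu; apply: eq_integrable.
  have iev : mu.-integrable D (EFin \o (fun x => mxdot (v x) (v x) / e)).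
    by have := integrableZr mD e^-1 iv; apply: eq_integrable.
  apply: (@le_trans _ _ (2 * \int[mu]_(x in D) `|mxdot (u x) (v x)|)).
    by rewrite ler_wpM2l//; exact: le_normr_Rintegral.
  rewrite /ip -RintegralZl// -[X in _ <= X + _]RintegralZl// -[X in _ <= _ +
    X]RintegralZr//.
  rewrite -RintegralD//; apply: le_Rintegral => //.
  - by have := integrableZl mD 2 iuvn; apply: eq_integrable.
  - by have := integrableD mD ieu iev; apply: eq_integrable.
  - by move=> x _; exact: norm_mxdot_le.
have := L2norm_sqr Lu; set N := L2norm mu D u => NE.
have N0 : 0 <= N by exact: sqrtr_ge0.
move: N0; rewrite le_eqVlt => /predU1P[N0|N0].
  rewrite -N0 mulr0; apply/ler_addgt0Pr => e e0; rewrite add0r.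
  (* When [u] has norm 0 the weight may be arbitrarily large; this one leaves at most [e], the 1
     guarding against [v] of norm 0. *)
  have e1 : 0 < (ip mu D v v + 1) / e by rewrite divr_gt0// ltr_wpDl.
  have := young _ e1; rewrite -NE -N0 expr0n/= mulr0 add0r invf_div mulrA.
  have : ip mu D v v * e / (ip mu D v v + 1) <= e.
    by rewrite ler_pdivrMr ?ltr_wpDl// mulrC ler_wpM2l ?(ltW e0)// lerDl.
  have := normr_ge0 (ip mu D u v); lra.
have := young _ (divr_gt0 ltr01 N0); rewrite -NE invf_div divr1 mul1r.
rewrite expr2 mulrA mulVf ?gt_eqF// mul1r.
have : 0 <= N * ip mu D v v by rewrite mulr_ge0// ltW.
have := normr_ge0 (ip mu D u v); rewrite mulrDl mul1r; lra.
Qed.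

End L2_theory.

(** No measurability enters, the integral of a nonnegative function being a supremum over the simple
    functions below it. The dominating function in [bochner_L1_ip], the norm of [f t], carries no
    measurability in t. *)
Lemma le_ge0_integral (R : realType) (disp : measure_display) (X : measurableType disp)
    (mu : {measure set X -> \bar R}) (D : set X) (f g : X -> \bar R) :
  (forall x, D x -> 0 <= f x)%E -> (forall x, D x -> f x <= g x)%E ->
  (\int[mu]_(x in D) f x <= \int[mu]_(x in D) g x)%E.
Proof.
move=> f0 fg; rewrite !ge0_integralE//; last by move=> x Dx; apply: le_trans (fg x Dx);
  exact: f0.
apply: ereal_sup_le => _ [h hf <-]; exists h => // x.
apply: (le_trans (hf x)); rewrite !patchE; case: ifP => //.
by rewrite inE => /fg.
Qed.

(* t |-> ip (f t) v is only Lebesgue measurable: it agrees a.e. with a Borel function. *)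
Lemma bochner_L1_ip (R : realType) (disp : measure_display) (X : measurableType disp)
    (mu : {measure set X -> \bar R}) (D : set X) (p q : nat) (T : R)
    (f : R -> X -> 'M[R]_(p, q)) (v : X -> 'M[R]_(p, q)) :
  bochner_L1 mu D T f -> L2 mu D v ->
  exists2 F : R -> R, (@lebesgue_measure R).-integrable `]0, T[ (EFin \o F) &
    {ae @lebesgue_measure R, forall t, 0 < t < T -> F t = ip mu D (f t) v}.
Proof.
move=> [Lf [fn simplefn [N [mN N0 subN]]] fin] Lv.
have [mD _ _] := Lv.
have [C C0 HC] := ip_le_L2norm Lv.
have Lfn n t : L2 mu D (fn n t).
  have [k [A [h [mA Lh fnE]]]] := simplefn n.
  by rewrite fnE; exact: L2_sumZ.
(* Multiplying by the indicator of [E] makes the approximations converge at every t, so their limit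
   [F] is Borel. *)
pose E := `]0, T[%classic `\` N.
have mE : measurable E by apply: measurableD.
pose G n t := \1_E t * ip mu D (fn n t) v.
pose F t := \1_E t * ip mu D (f t) v.
have mG n : measurable_fun setT (G n).
  apply: measurable_funM; first exact: measurable_indic.
  have [k [A [h [mA Lh fnE]]]] := simplefn n.
  have -> : (fun t => ip mu D (fn n t) v) = (fun t => \sum_i \1_(A i) t * ip mu D (h i) v).
    by apply/funext => t; rewrite fnE ip_sumZl.
  by apply: measurable_sum => i; apply: measurable_funM => //; exact: measurable_indic.
have GF t : G n t @[n --> \oo] --> F t.
  rewrite /G /F indicE; have [tE|tE] := boolP (t \in E); last first.
    by under eq_fun do rewrite mul0r; rewrite mul0r; exact: cvg_cst.
  under eq_fun do rewrite mul1r; rewrite mul1r.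
  move: tE; rewrite inE => -[/= tT tN]; rewrite in_itv/= in tT.
  have Lft := Lf t tT.
  have : L2_cvg mu D (fun n => fn n t) (f t).
    by have := contra_not (@subN t) tN => /contrapT; apply.
  move=> /fine_cvg/(continuous_cvg _ (@sqrt_continuous R 0)); rewrite sqrtr0 => cv.
  apply/cvgrPdist_le => e e0; have eC : 0 < e / C by rewrite divr_gt0.
  move/cvgrPdist_le : cv => /(_ _ eC); apply: filterS => n.
  rewrite sub0r normrN ger0_norm ?sqrtr_ge0// => Hn.
  rewrite distrC -ipB//; apply: (le_trans (HC _ (L2B (Lfn n t) Lft))).
  by rewrite mulrC -ler_pdivlMr.
have mF : measurable_fun setT F by apply: measurable_fun_cvg mG _ => t _; exact: GF.
exists F; last first.
  exists N; split => // t /= /not_implyP[tT HF]; apply: contrapT => tN; apply: HF.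
  by rewrite /F indicE mem_set ?mul1r//; split => //=; rewrite in_itv.
(* With [C^-1] moved onto [F], the bound is exactly the norm whose integral is assumed finite. *)
have iF : (@lebesgue_measure R).-integrable `]0, T[ (EFin \o (fun t => C^-1 * F t)).
  apply/integrableP; split.
    apply/measurable_EFinP; apply: measurable_funTS; exact: measurable_funM.
  apply: le_lt_trans fin; apply: le_ge0_integral => // t tT.
  rewrite /= in_itv/= in tT; rewrite lee_fin normrM gtr0_norm ?invr_gt0//.
  rewrite ler_pdivrMl// /F normrM; apply: le_trans (HC _ (Lf t tT)).
  by rewrite ger0_norm// ler_piMl// indicE; case: (_ \in _).
have mI : measurable (`]0, T[%classic : set (measurableTypeR R)) by exact: measurable_itv.
have := integrableZl mI C iF; apply: eq_integrable => // t _ /=.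
by rewrite -EFinM mulrA divff ?mul1r// gt_eqF.
Qed.

(** * Galerkin approximation *)

Section galerkin_theory.
Context (R : realType) (d m : nat).
Variables (Omega GD : set 'rV[R]_d) (phi : 'I_m -> 'rV[R]_d -> 'rV[R]_d).
Local Notation V := (space_V Omega GD).
Local Notation mass := (\matrix_(j, k) ip (lebesgue_rV R d) Omega (phi j) (phi k)).

(** Partial sums stay in the Galerkin space, hence in V, the only place where the form is known to
    be bilinear; [bilinear_combination] needs this for its induction over the index list. *)
Lemma combination_sum (r : seq 'I_m) (c : 'I_m -> R) :
  exists c', (fun x => \sum_(j <- r) c j *: phi j x) = combination phi c'.
Proof.
elim: r => [|i r [c' IH]].
  exists (fun=> 0); apply/funext => x; rewrite big_nil /combination.
  by under eq_bigr do rewrite scale0r; rewrite big1.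
exists (fun j => c' j + (j == i)%:R * c i); apply/funext => x.
rewrite big_cons (congr1 (fun h => h x) IH) /combination.
under [RHS]eq_bigr do rewrite scalerDl.
rewrite big_split/= addrC; congr (_ + _).
rewrite (bigD1 i)//= eqxx mul1r big1 ?addr0// => j /negbTE ->.
by rewrite mul0r scale0r.
Qed.

Lemma combination_in_Vh (c : 'I_m -> R) : space_Vh Omega phi (combination phi c).
Proof. by exists c; apply: aeW. Qed.

Lemma basis_in_Vh (j : 'I_m) : space_Vh Omega phi (phi j).
Proof.
exists (fun i => (i == j)%:R); apply: aeW => x _.
rewrite /combination (bigD1 j)//= eqxx scale1r big1 ?addr0// => i /negbTE ->.
by rewrite scale0r.
Qed.

Hypothesis hVh : space_Vh Omega phi `<=` V.
Hypothesis hphi : lin_indep Omega phi.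

Lemma basis_L2 (j : 'I_m) : L2 (lebesgue_rV R d) Omega (phi j).
Proof. by have [[]] := hVh (basis_in_Vh j). Qed.

(** Initial conditions hold almost everywhere on the domain; linear independence turns them into the
    exact initial values of the coefficients. *)
Lemma combination_eq_inj (c c' : 'I_m -> R) v :
  eq_H Omega (combination phi c) v -> eq_H Omega (combination phi c') v -> c = c'.
Proof.
move=> cv c'v; apply/funext => j; apply/eqP; rewrite -subr_eq0; apply/eqP.
apply: (@hphi (fun j => c j - c' j)).
have aeF := ae_filter_ringOfSetsType (lebesgue_rV R d).
apply: filterS2 cv c'v => x cv c'v Ox.
have := cv Ox; rewrite -(c'v Ox) => /eqP; rewrite -subr_eq0 => /eqP <-.
by rewrite /combination -sumrB; apply: eq_bigr => i _; rewrite scalerBl.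
Qed.

(** A Gram matrix: a row vector in its kernel gives a combination orthogonal to every [phi k], hence
    to itself, so it vanishes almost everywhere and linear independence applies. *)
Lemma mass_unit : mass \in unitmx.
Proof.
rewrite -row_free_unit; apply: inj_row_free => v vM; apply/rowP => i; rewrite mxE.
pose u := combination phi (v 0).
have Lu : L2 (lebesgue_rV R d) Omega u.
  by apply: L2_sumZ => [|j]; [case: (basis_L2 i)|exact: basis_L2].
suff u0 : ip (lebesgue_rV R d) Omega u u = 0 by exact: hphi (ip_eq0 Lu u0) i.
have uE w : L2 (lebesgue_rV R d) Omega w ->
    ip (lebesgue_rV R d) Omega u w = \sum_j v 0 j * ip (lebesgue_rV R d) Omega (phi j) w.
  exact: ip_sumZl basis_L2.
rewrite uE//; apply: big1 => j _; apply/eqP; rewrite mulf_eq0; apply/orP; right; apply/eqP.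
have <- : ip (lebesgue_rV R d) Omega u (phi j) = ip (lebesgue_rV R d) Omega (phi j) u.
  by rewrite /ip; apply: eq_Rintegral => x _; rewrite mxdotC.
rewrite uE; last exact: basis_L2.
have := congr1 (fun w : 'rV_m => w 0 j) vM; rewrite !mxE; apply: etrans.
by apply: eq_bigr => k _; rewrite mxE.
Qed.

Variable a : ('rV[R]_d -> 'rV[R]_d) -> ('rV[R]_d -> 'rV[R]_d) -> R.
Hypothesis ha : bilinear_on V a.

Lemma bilinear_combination (c : 'I_m -> R) (k : 'I_m) :
  a (combination phi c) (phi k) = \sum_j c j * a (phi j) (phi k).
Proof.
have Vphi j : V (phi j) by exact: hVh (basis_in_Vh j).
have a0 : a (fun=> 0) (phi k) = 0.
  have V0 : V (fun=> 0).
    have [c' E] := combination_sum [::] c.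
    have -> : (fun=> 0) = combination phi c'.
      by rewrite -E; apply/funext => x; rewrite big_nil.
    exact: hVh (combination_in_Vh c').
  (* Additivity and homogeneity come combined, and the scalar -1 gives a(0) = - a(0) + a(0). *)
  have [+ _] := ha (-1) V0 V0 (Vphi k).
  have -> : (fun x : 'rV[R]_d => -1 *: (fun=> 0 : 'rV[R]_d) x + (fun=> 0) x) = (fun=> 0).
    by apply/funext => x; rewrite scaler0 addr0.
  by rewrite mulN1r addNr.
rewrite /combination; elim: (index_enum _) => [|j r IH].
  by rewrite big_nil -[RHS]a0; congr a; apply/funext => x; rewrite big_nil.
rewrite big_cons -IH.
have Vr : V (fun x => \sum_(j <- r) c j *: phi j x).
  have [c' ->] := combination_sum r c; exact: hVh (combination_in_Vh c').
have [<- _] := ha (c j) (Vphi j) Vr (Vphi k).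
by congr a; apply/funext => x; rewrite big_cons.
Qed.

Variables (GN : set 'rV[R]_d) (T : R) (K : R -> R) (f g : R -> 'rV[R]_d -> 'rV[R]_d).
Variables (v0 v1 : 'rV[R]_d -> 'rV[R]_d) (q : 'I_m -> R -> R) (c0 c1 : 'I_m -> R).
Hypotheses (T0 : 0 < T) (hv0 : eq_H Omega v0 (combination phi c0))
  (hv1 : eq_H Omega v1 (combination phi c1)).
Hypothesis qE : forall k, {ae @lebesgue_measure R, forall t, 0 < t < T ->
  q k t = ip (lebesgue_rV R d) Omega (f t) (phi k)
          + ip (surface_measure R d) GN (g t) (trace Omega (phi k))}.
Local Notation stiff := (\matrix_(j, k) a (phi j) (phi k)).

Let equationE (al al2 : 'I_m -> R -> R) (u : R -> 'rV[R]_d -> 'rV[R]_d) t k :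
  (forall s, 0 <= s <= T -> u s = combination phi (al ^~ s)) -> 0 < t < T ->
  ip (lebesgue_rV R d) Omega (combination phi (al2 ^~ t)) (phi k) + a (u t) (phi k)
    - \int[@lebesgue_measure R]_(s in `[0, t]) (K (t - s) * a (u s) (phi k)) =
  \sum_j al2 j t * mass j k + memory_load K stiff al k t.
Proof.
move=> uE tT; rewrite [X in X + _ - _](ip_sumZl (al2 ^~ t) basis_L2 (basis_L2 k)).
rewrite -addrA; congr (_ + _); first by apply: eq_bigr => j _; rewrite mxE.
rewrite /memory_load /volterra uE ?bilinear_combination; last by lra.
congr (_ - _); first by apply: eq_bigr => j _; rewrite mxE.
apply: eq_Rintegral => s; rewrite inE/= in_itv/= => st; rewrite uE; last by lra.
by rewrite bilinear_combination; congr (_ * _); apply: eq_bigr => j _; rewrite mxE.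
Qed.

Lemma galerkin_solution_volterra u : galerkin_solution Omega phi GN T K a f g v0 v1 u ->
  exists al al1 al2, volterra_solution T K mass stiff q c0 c1 al al1 al2 /\
    forall t, 0 <= t <= T -> u t = combination phi (al ^~ t).
Proof.
move=> [al [al1 [al2 [uE dal u0 u1 eqn]]]]; exists al, al1, al2; split=> //.
have aeF := ae_filter_ringOfSetsType (@lebesgue_measure R).
split.
- move=> j; have [? ? ?] := dal j; split => //.
  by apply: filterS eqn => t Ht /Ht[].
- move=> j; suff -> : c0 = al ^~ 0 by [].
  apply: (@combination_eq_inj _ _ v0); first exact/ae_eq_sym.
  by rewrite -uE// lexx ltW.
- move=> j; suff -> : c1 = al1 ^~ 0 by [].
  by apply: (@combination_eq_inj _ _ v1) => //; exact/ae_eq_sym.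
- have /filter_forall qE' := qE; apply: filterS2 eqn qE' => t Ht qt tT k.
  by rewrite qt//; have [_ /(_ k) <-] := Ht tT; rewrite (equationE al2 k uE tT).
Qed.

Lemma volterra_galerkin_solution al al1 al2 :
  volterra_solution T K mass stiff q c0 c1 al al1 al2 ->
  galerkin_solution Omega phi GN T K a f g v0 v1 (fun t => combination phi (al ^~ t)).
Proof.
move=> [dal al0 al10 eqn]; exists al, al1, al2.
have aeF := ae_filter_ringOfSetsType (@lebesgue_measure R).
split => //.
- by move=> j; have [] := dal j.
- by have -> : al ^~ 0 = c0 by [apply/funext]; exact/ae_eq_sym.
- by have -> : al1 ^~ 0 = c1 by [apply/funext]; exact/ae_eq_sym.
- have /filter_forall qE' := qE.
  have /filter_forall dal2 : forall j, {ae @lebesgue_measure R, forall t, 0 < t < T ->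
      is_derive t (1 : R) (al1 j) (al2 j t)} by move=> j; have [] := dal j.
  apply: filterS3 eqn dal2 qE' => t Ht dt qt tT; split=> [j|k]; first exact: dt.
  by rewrite (@equationE al al2 (fun t => combination phi (al ^~ t)) t k)// Ht// qt.
Qed.

End galerkin_theory.

Theorem lemma1 (R : realType) (d : nat) (hd : (1 <= d <= 3)%N)
    (Omega GD GN : set 'rV[R]_d)
    (hOmega : polygonal_domain Omega)
    (hmGD : (hausdorff_outer R d d.-1).-cara.-measurable GD)
    (hmGN : (hausdorff_outer R d d.-1).-cara.-measurable GN)
    (hbd : boundary Omega = GD `|` GN) (hdisj : GD `&` GN = set0)
    (hGD : surface_measure R d GD != 0%E)
    (a : ('rV[R]_d -> 'rV[R]_d) -> ('rV[R]_d -> 'rV[R]_d) -> R)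
    (ha : elliptic_form Omega (space_V Omega GD) a)
    (T : R) (hT : 0 < T)
    (K : R -> R) (kappa : R)
    (hK0 : forall t : R, 0 < t < T -> 0 <= K t)
    (hK1 : forall t : R, 0 < t < T -> derivable K t 1 /\ derive1 K t <= 0)
    (hKint : (@lebesgue_measure R).-integrable `]0, T[ (EFin \o K))
    (hkappa : \int[@lebesgue_measure R]_(t in `]0, T[) `|K t| = kappa)
    (hkappa1 : kappa < 1)
    (f g : R -> 'rV[R]_d -> 'rV[R]_d)
    (hf : bochner_L1 (lebesgue_rV R d) Omega T f)
    (hg : bochner_L1 (surface_measure R d) GN T g)
    (m : nat) (phi : 'I_m -> 'rV[R]_d -> 'rV[R]_d)
    (hVh : space_Vh Omega phi `<=` space_V Omega GD)
    (hphi : lin_indep Omega phi)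
    (dom0 dom1 : set ('rV[R]_d -> 'rV[R]_d))
    (P0 P1 : ('rV[R]_d -> 'rV[R]_d) -> 'rV[R]_d -> 'rV[R]_d)
    (hP0 : projection_onto_Vh Omega phi dom0 P0)
    (hP1 : projection_onto_Vh Omega phi dom1 P1)
    (u0 u1 : 'rV[R]_d -> 'rV[R]_d) (hu0 : dom0 u0) (hu1 : dom1 u1) :
  exists2 um : R -> 'rV[R]_d -> 'rV[R]_d,
    galerkin_solution Omega phi GN T K a f g (P0 u0) (P1 u1) um &
    forall w : R -> 'rV[R]_d -> 'rV[R]_d,
      galerkin_solution Omega phi GN T K a f g (P0 u0) (P1 u1) w ->
      forall t : R, 0 <= t <= T -> eq_H Omega (w t) (um t).
Proof.
have [ba _ _ _] := ha.
have [c0 hc0] : space_Vh Omega phi (P0 u0) by have [_ _ _ + _] := hP0; exact.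
have [c1 hc1] : space_Vh Omega phi (P1 u1) by have [_ _ _ + _] := hP1; exact.
(* [trace] is a choice among the functions satisfying [is_trace]; membership of [phi k] in V
   provides one, so the chosen function is a genuine trace, square integrable on the boundary and
   therefore on its measurable part [GN]. *)
have traceL2 k : L2 (surface_measure R d) GN (trace Omega (phi k)).
  have [_ [w trw _]] := hVh _ (basis_in_Vh Omega phi k).
  have [[mB mtr fin] _] : is_trace Omega (phi k) (trace Omega (phi k)).
    by apply: (@getPex _ (is_trace Omega (phi k))); exists w.
  have GNB : GN `<=` boundary Omega by rewrite hbd; exact: subsetUr.
  split; [exact: hmGN|by move=> i j; exact: measurable_funS mB GNB (mtr i j)|].
  apply: le_lt_trans fin; apply: (@ge0_subset_integral _ _ _ (surface_measure R d) _ _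
    hmGN mB _ _ _ GNB).
    by apply/measurable_EFinP; exact: measurable_mxdot.
  by move=> x _; rewrite lee_fin mxdot_ge0.
have /choice[q hq] : forall k, exists F : R -> R,
    (@lebesgue_measure R).-integrable `]0, T[ (EFin \o F) /\
    {ae @lebesgue_measure R, forall t, 0 < t < T ->
      F t = ip (lebesgue_rV R d) Omega (f t) (phi k)
          + ip (surface_measure R d) GN (g t) (trace Omega (phi k))}.
  move=> k; have [F iF FE] := bochner_L1_ip hf (basis_L2 hVh k).
  have [G iG GE] := bochner_L1_ip hg (traceL2 k).
  exists (fun t => F t + G t); split.
    have mI : measurable (`]0, T[%classic :
      set (measurableTypeR R)) by exact: measurable_itv.
    by have := integrableD mI iF iG; apply: eq_integrable.
  have aeF := ae_filter_ringOfSetsType (@lebesgue_measure R).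
  by apply: filterS2 FE GE => t Ft Gt tT; rewrite Ft// Gt.
have iq k := (hq k).1; have qE k := (hq k).2.
pose S : 'M[R]_m := \matrix_(j, k) a (phi j) (phi k).
have uM := mass_unit hVh hphi.
have [al [al1 [al2 sol]]] := volterra_system_exists S c0 c1 hT hKint uM iq.
exists (fun t => combination phi (al ^~ t)).
  exact: (volterra_galerkin_solution hVh ba hc0 hc1 qE sol).
move=> w /(galerkin_solution_volterra hVh hphi ba hT hc0 hc1 qE)[be [be1 [be2 [solw
  wE]]]] t tT.
have E : (fun j => be j t) = (fun j => al j t).
  by apply/funext => j; exact: (volterra_system_unique hT hKint uM solw sol j tT).
by rewrite (wE t tT) E; exact: aeW.
Qed.
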